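(* Let $f\in\mathcal F$ be nonzero. Then the pairing $\langle\;,\;\rangle_f:\ker f\times\ker f^\ast\to\mathbb F_q$ exhibits $\ker f$ as the Pontryagin dual of $\ker f^\ast$ as a topological $\mathbb F_q$-vector space: the pairing is continuous, and the induced maps $\ker f\to\operatorname{Hom}_{\mathbb F_q}(\ker f^\ast,\mathbb F_q)$ and $\ker f^\ast\to\operatorname{Hom}_{\mathbb F_q}(\ker f,\mathbb F_q)$ are isomorphisms of topological $\mathbb F_q$-vector spaces.
   Context: Let $p$ be a prime, $q$ a power of $p$, and $C$ an algebraically closed field containing $\mathbb F_q$ which is complete with respect to a non-archimedean absolute value $|\cdot|$. For $z\in C$ and $n\in\mathbb Z$, $z^{q^n}$ denotes the unique $q^n$-th power (for $n<0$, the unique $q^{-n}$-th root). Let $\mathcal F$ be the set of formal sums $f=\sum_{n\in\mathbb Z}a_n\tau^n$ with $a_n\in C$ such that the series $f(z)=\sum_{n\in\mathbb Z}a_nz^{q^n}$ converges for every $z\in C$ (equivalently, $|a_n|\to0$ as $n\to-\infty$ and $|a_n|^{1/q^n}\to0$ as $n\to+\infty$); each $f\in\mathcal F$ defines an $\mathbb F_q$-linear map $C\to C$. $\mathcal F$ is a ring under termwise addition and composition $(\sum_i a_i\tau^i)\circ(\sum_j b_j\tau^j)=\sum_n\big(\sum_{i+j=n}a_ib_j^{q^i}\big)\tau^n$, which corresponds to composition of maps; an element $c\in C$ is identified with $c\tau^0$, the multiplication-by-$c$ map. $\ker f=\{z\in C: f(z)=0\}$, with the subspace topology from $C$. The adjoint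 of $f=\sum a_n\tau^n$ is $f^\ast=\sum_n a_n^{1/q^n}\tau^{-n}\in\mathcal F$. For nonzero $f\in\mathcal F$ and $\alpha\in\ker f$ there is a unique $g_\alpha\in\mathcal F$ with $f\circ\alpha=g_\alpha\circ(1-\tau)$; for $\beta\in\ker f^\ast$ one defines $\langle\alpha,\beta\rangle_f=g_\alpha^\ast(\beta)$, which lies in $\mathbb F_q$ and is $\mathbb F_q$-bilinear. $\operatorname{Hom}_{\mathbb F_q}(M,\mathbb F_q)$ denotes continuous $\mathbb F_q$-linear maps ($\mathbb F_q$ discrete) with the compact-open topology. *)

(* Defs.v *)
From HB Require Import structures.
From mathcomp Require Import all_boot all_order all_algebra all_field.
From mathcomp Require Import all_classical all_reals all_analysis.

Set Implicit Arguments.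
Unset Strict Implicit.
Unset Printing Implicit Defensive.

Import Order.TTheory GRing.Theory Num.Theory.

Local Open Scope classical_set_scope.
Local Open Scope ring_scope.

(* An algebraically closed field with an embedding of the finite field F (so
   that q = #|F|), complete for a non-archimedean absolute value. The absolute
   value is allowed to be trivial. *)
Record nonArchClosedField (R : realType) (F : finFieldType) := {
  nacf_field : closedFieldType ;
  nacf_emb : {rmorphism F -> nacf_field} ;
  nacf_abs : nacf_field -> R ;
  nacf_abs_ge0 : forall x, 0 <= nacf_abs x ;
  nacf_abs_eq0 : forall x, (nacf_abs x == 0) = (x == 0) ;
  nacf_absM : forall x y, nacf_abs (x * y) = nacf_abs x * nacf_abs y ;
  nacf_absD : forall x y,
    nacf_abs (x + y) <= Num.max (nacf_abs x) (nacf_abs y) ;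
  nacf_complete : forall u : nat -> nacf_field,
    (forall e, 0 < e -> exists N, forall m n, (N <= m)%N -> (N <= n)%N ->
       nacf_abs (u m - u n) < e) ->
    exists l, forall e, 0 < e -> exists N, forall n, (N <= n)%N ->
       nacf_abs (u n - l) < e
}.

Definition nacf_sort R F (C : nonArchClosedField R F) : Type := nacf_field C.
Coercion nacf_sort : nonArchClosedField >-> Sortclass.

HB.instance Definition _ R F (C : nonArchClosedField R F) :=
  GRing.ClosedField.copy (nacf_sort C) (nacf_field C).

HB.instance Definition _ R F (C : nonArchClosedField R F) :=
  isPointed.Build (nacf_sort C) 0.

Section absolute_value.
Context {R : realType} {F : finFieldType} {C : nonArchClosedField R F}.

Definition absv (x : C) : R := nacf_abs x.

Definition Femb : {rmorphism F -> C} := nacf_emb C.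

Lemma absv_ge0 x : 0 <= absv x. Proof. exact: nacf_abs_ge0. Qed.
Lemma absv_eq0 x : (absv x == 0) = (x == 0). Proof. exact: nacf_abs_eq0. Qed.
Lemma absvM x y : absv (x * y) = absv x * absv y.
Proof. exact: nacf_absM. Qed.
Lemma absvD x y : absv (x + y) <= Num.max (absv x) (absv y).
Proof. exact: nacf_absD. Qed.

Lemma absv0 : absv 0 = 0. Proof. by apply/eqP; rewrite absv_eq0. Qed.

Lemma absv1 : absv 1 = 1.
Proof.
have n0 : absv 1 != 0 by rewrite absv_eq0 oner_eq0.
by apply: (mulfI n0); rewrite -absvM !mulr1.
Qed.

Lemma absvX x n : absv (x ^+ n) = absv x ^+ n.
Proof. by elim: n => [|n IH]; rewrite ?expr0 ?absv1// !exprS absvM IH. Qed.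

Lemma absvN x : absv (- x) = absv x.
Proof.
rewrite -mulN1r absvM; suff -> : absv (-1) = 1 by rewrite mul1r.
apply/eqP; rewrite -(@eqrXn2 _ 2) ?absv_ge0//.
by rewrite -absvX sqrrN expr1n absv1 expr1n.
Qed.

Lemma absvB x y : absv (x - y) <= Num.max (absv x) (absv y).
Proof. by rewrite -[absv y]absvN absvD. Qed.

Lemma absv_distC x y : absv (x - y) = absv (y - x).
Proof. by rewrite -absvN opprB. Qed.

Lemma absvD_lt x y e : absv x < e -> absv y < e -> absv (x + y) < e.
Proof. by move=> xe ye; rewrite (le_lt_trans (absvD _ _))// gt_max xe ye. Qed.

Lemma absvD_le x y e : absv x <= e -> absv y <= e -> absv (x + y) <= e.
Proof. by move=> xe ye; rewrite (le_trans (absvD _ _))// ge_max xe ye. Qed.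

Lemma mdist_absvxx x : absv (x - x) = 0. Proof. by rewrite subrr absv0. Qed.

Lemma mdist_absv_eq0 x y : absv (x - y) = 0 -> x = y.
Proof. by move/eqP; rewrite absv_eq0 subr_eq0 => /eqP. Qed.

Lemma mdist_absv_triangle y x z :
  absv (x - z) <= absv (x - y) + absv (y - z).
Proof.
have -> : x - z = (x - y) + (y - z) by rewrite addrA subrK.
apply: (le_trans (absvD _ _)).
by rewrite ge_max lerDl lerDr !absv_ge0.
Qed.

HB.instance Definition _ := @isMetric.Build R (nacf_sort C)
  (fun x y => absv (x - y)) mdist_absvxx mdist_absv_eq0 absv_distC
  mdist_absv_triangle.

Lemma ball_absv (x : C) (e : R) : ball x e = [set y | absv (x - y) < e].
Proof. exact: ballEmdist. Qed.

End absolute_value.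

Section fractional_powers.
Context {R : realType} {F : finFieldType} {C : nonArchClosedField R F}.
Implicit Types (x y z : C) (m n : int) (k : nat).

Local Notation q := #|F|.

(* z^(q^n) for n in Z. As Negz k stands for -(k+1), the second branch is the
   q^(k+1)-th root, which exists (qpowNK) and is unique (qX_inj). *)
Definition qpow n z : C :=
  match n with
  | Posz k => z ^+ (q ^ k)
  | Negz k => xget 0 [set y | y ^+ (q ^ k.+1) = z]
  end.

Lemma qpow_nat k z : qpow k%:Z z = z ^+ (q ^ k). Proof. by []. Qed.

Lemma qX_gt0 k : (0 < q ^ k)%N.
Proof. by rewrite expn_gt0 (ltn_trans _ (finNzRing_gt1 F)). Qed.

Lemma qX_pchar k : ([pchar C]).-nat (q ^ k)%N.
Proof.
have [p pp pF] := finPcharP F.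
have pC : p \in [pchar C] by rewrite (fmorph_pchar (@Femb R F C)).
rewrite pnatX; apply/orP; left.
rewrite (eq_pnat _ (pcharf_eq pC)).
by have /abelian.abelem_pgroup := abelian.fin_ring_pchar_abelem pF; rewrite /pgroup.pgroup cardsT.
Qed.

Lemma qX_additive k x y : (x + y) ^+ (q ^ k) = x ^+ (q ^ k) + y ^+ (q ^ k).
Proof. exact/exprDn_pchar/qX_pchar. Qed.

Lemma qX_inj k : injective (fun x => x ^+ (q ^ k)).
Proof.
move=> x y /= xy; apply/eqP; rewrite -subr_eq0.
have: (x - y + y) ^+ (q ^ k) = y ^+ (q ^ k) by rewrite subrK.
rewrite qX_additive => /eqP; rewrite addrC -[eqbRHS]addr0 (inj_eq (addrI _)).
by rewrite expf_eq0 qX_gt0.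
Qed.

Lemma qpowNK k z : qpow (Negz k) z ^+ (q ^ k.+1) = z.
Proof.
apply: (@xgetPex _ 0 [set y | y ^+ (q ^ k.+1) = z]).
have /closed_rootP[y] : size ('X^(q ^ k.+1) - z%:P) != 1%N.
  by rewrite size_XnsubC ?qX_gt0// eqSS -lt0n qX_gt0.
rewrite rootE !hornerE ?hornerXn subr_eq0 => /eqP yz; by exists y.
Qed.

Lemma qpowP (j k : nat) z y :
  qpow (j%:Z - k%:Z) z = y <-> y ^+ (q ^ k) = z ^+ (q ^ j).
Proof.
case: (leqP k j) => [kj|jk].
  rewrite subzn//= -{2}(subnK kj) expnD exprM.
  by split => [->//|/qX_inj ->].
have -> : j%:Z - k%:Z = Negz (k - j).-1.
  by rewrite NegzE prednK ?subn_gt0// -subzn 1?ltnW// opprB.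
rewrite -{2}(subnK (ltnW jk)) expnD exprM.
have -> : (k - j)%N = (k - j).-1.+1 by rewrite prednK// subn_gt0.
split => [<-|/qX_inj yz]; first by rewrite qpowNK.
by apply: (@qX_inj (k - j).-1.+1); rewrite /= qpowNK.
Qed.

Lemma intBP n : exists j k : nat, n = j%:Z - k%:Z.
Proof.
case: n => k; first by exists k, 0%N; rewrite subr0.
by exists 0%N, k.+1; rewrite NegzE sub0r.
Qed.

Lemma qpowD n x y : qpow n (x + y) = qpow n x + qpow n y.
Proof.
have [j [k ->]] := intBP n; apply/qpowP.
by rewrite !qX_additive; congr (_ + _); apply/qpowP.
Qed.

Lemma qpowM n x y : qpow n (x * y) = qpow n x * qpow n y.
Proof.
have [j [k ->]] := intBP n; apply/qpowP.
by rewrite !exprMn; congr (_ * _); apply/qpowP.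
Qed.

Lemma qpow0z z : qpow 0 z = z. Proof. by rewrite /= expn0 expr1. Qed.

Lemma qpow1z z : qpow 1 z = z ^+ q. Proof. by rewrite /= expn1. Qed.

Lemma qpow_comp m n z : qpow (m + n) z = qpow m (qpow n z).
Proof.
have [a [b ->]] := intBP m; have [c [d ->]] := intBP n.
rewrite addrACA -opprD -!PoszD; apply/qpowP.
rewrite expnD exprM (_ : _ ^+ (q ^ b) = qpow (c%:Z - d%:Z) z ^+ (q ^ a)); last exact/qpowP.
rewrite -exprM mulnC exprM (_ : _ ^+ (q ^ d) = z ^+ (q ^ c)); last exact/qpowP.
by rewrite -exprM -expnD addnC.
Qed.

Lemma qpow_Femb n (a : F) : qpow n (Femb a) = Femb a.
Proof.
have Fa k : (Femb a : C) ^+ (q ^ k) = Femb a.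
  elim: k => [|k IH]; first by rewrite expn0 expr1.
  by rewrite expnS exprM -rmorphXn expf_card.
by have [j [k ->]] := intBP n; apply/qpowP; rewrite !Fa.
Qed.

Lemma qpow0 n : qpow n 0 = 0.
Proof. by rewrite -(rmorph0 (@Femb R F C)) qpow_Femb. Qed.

Lemma qpow1 n : qpow n 1 = 1.
Proof. by rewrite -(rmorph1 (@Femb R F C)) qpow_Femb. Qed.

Lemma qpowN n x : qpow n (- x) = - qpow n x.
Proof. by apply/eqP; rewrite -subr_eq0 opprK -qpowD addNr qpow0. Qed.

Lemma Femb_fixed x : x ^+ q = x -> exists a : F, Femb a = x.
Proof.
move=> xq; have := congr1 (fun P => (map_poly Femb P).[x]) (finField_genPoly F).
rewrite rmorphB /= map_polyXn map_polyX !hornerE ?hornerXn xq subrr.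
rewrite rmorph_prod horner_prod => /esym/eqP/prodf_eq0[a _].
rewrite rmorphB /= map_polyX map_polyC !hornerE subr_eq0 => /eqP ->; by exists a.
Qed.

Lemma absv_qpowN k z : absv (qpow (Negz k) z) ^+ (q ^ k.+1) = absv z.
Proof. by rewrite -absvX qpowNK. Qed.

Lemma absv_qpowN_lt k z (e : R) : 0 < e -> absv z < e ^+ (q ^ k.+1) ->
  absv (qpow (Negz k) z) < e.
Proof.
move=> e0; rewrite -(absv_qpowN k z) ltr_pXn2r// ?qX_gt0// nnegrE ?absv_ge0//.
exact: ltW.
Qed.

Lemma absv_qpowN_le k z (B : R) : 1 <= B -> absv z <= B ->
  absv (qpow (Negz k) z) <= B.
Proof.
move=> B1 zB; rewrite leNgt; apply/negP => By.
have: absv (qpow (Negz k) z) <= absv (qpow (Negz k) z) ^+ (q ^ k.+1).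
  by rewrite ler_eXnr ?qX_gt0// ltW// (le_lt_trans B1).
by rewrite absv_qpowN leNgt (le_lt_trans zB By).
Qed.

End fractional_powers.

Arguments qpow : simpl never.

Section two_sided_series.
Context {R : realType} {F : finFieldType} {C : nonArchClosedField R F}.
Implicit Types (u v : nat -> C) (a b : int -> C).

(* A sum over Z converges when its non-negative and negative halves both do. *)
Definition zcvg a : Prop :=
  cvgn (series (fun k => a (Posz k))) /\ cvgn (series (fun k => a (Negz k))).

Definition zsum a : C :=
  limn (series (fun k => a (Posz k))) + limn (series (fun k => a (Negz k))).

Definition null u := forall e : R, 0 < e -> \forall k \near \oo, absv (u k) < e.

Lemma cvgn_nullP u (l : C) : u @ \oo --> l <-> null (fun k => l - u k).
Proof.
split=> [ul e e0|ul].
  by have /cvg_ballP/(_ e e0) := ul; rewrite ball_absv.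
by apply/cvg_ballP => e e0; rewrite ball_absv; exact: ul.
Qed.

Lemma nullD u v : null u -> null v -> null (fun k => u k + v k).
Proof.
move=> u0 v0 e e0; near=> k.
by apply: absvD_lt; near: k; [exact: u0 | exact: v0].
Unshelve. all: by end_near. Qed.

Lemma nullN u : null u -> null (fun k => - u k).
Proof.
move=> u0 e e0; have [N _ Nu] := u0 e e0.
by exists N => // k /= Nk; rewrite absvN; exact: Nu.
Qed.

Lemma nullM (c : C) u : null u -> null (fun k => c * u k).
Proof.
move=> u0 e e0; have [->|c0] := eqVneq c 0.
  by near=> k; rewrite mul0r absv0.
have c0' : 0 < absv c by rewrite lt_neqAle absv_ge0 eq_sym absv_eq0 c0.
near=> k; rewrite absvM -ltr_pdivlMl// mulrC.
by near: k; apply: u0; rewrite divr_gt0.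
Unshelve. all: by end_near. Qed.

Lemma eq_null u v : u =1 v -> null u -> null v.
Proof. by move=> /funext ->. Qed.

Lemma nullS u : null u -> null (fun k => u k.+1).
Proof.
move=> u0 e e0; have [N _ Nu] := u0 e e0.
by exists N => // k /= Nk; apply: Nu; exact: leqW.
Qed.

Lemma nullSV u : null (fun k => u k.+1) -> null u.
Proof.
move=> u0 e e0; have [N _ Nu] := u0 e e0.
by exists N.+1 => // -[//|k] /= Nk; exact: Nu.
Qed.

Lemma null_const (c : C) : null (fun=> c) -> c = 0.
Proof.
move=> c0; apply/eqP; rewrite -absv_eq0; apply: contraT => cn0.
have cp : 0 < absv c by rewrite lt_neqAle absv_ge0 eq_sym cn0.
by have [N _ /(_ N (leqnn _))] := c0 _ cp; rewrite /= ltxx.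
Qed.

Lemma absv_sum_lt (I : Type) (r : seq I) (P : pred I) (f : I -> C) (e : R) :
  0 < e -> (forall i, P i -> absv (f i) < e) ->
  absv (\sum_(i <- r | P i) f i) < e.
Proof.
move=> e0 fe; elim/big_ind: _ => //; first by rewrite absv0.
by move=> x y; exact: absvD_lt.
Qed.

Lemma limn_nullP u (l : C) : null (fun k => l - u k) -> limn u = l.
Proof.
move=> ul; apply: cvg_lim; last exact/cvgn_nullP.
exact: metric_hausdorff.
Qed.

Lemma series_cvgP u : cvgn (series u) <-> null u.
Proof.
split=> [/cvgn_nullP cu|u0].
  apply: eq_null (nullD cu (nullN (nullS cu))) => k.
  rewrite [series u k.+1]seriesSr opprB addrC addrA subrK addrC addKr //.
have [l lu] : exists l : C, null (fun k => l - series u k).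
  have [|l lP] := @nacf_complete _ _ C (series u).
    move=> e e0; have [N _ Nu] := u0 e e0; exists N.
    have H m n : (N <= m)%N -> (m <= n)%N -> absv (series u n - series u m) < e.
      move=> Nm mn; rewrite sub_series_geq// big_seq_cond.
      apply: absv_sum_lt => // i; rewrite andbT mem_index_iota => /andP[mi _].
      exact/Nu/(leq_trans Nm).
    move=> m n Nm Nn; case: (leqP m n) => [mn|/ltnW nm]; last exact: H.
    by rewrite -[X in X < _]/(absv _) absv_distC; exact: H.
  exists l => e e0; have [N NP] := lP e e0; exists N => // k /= Nk.
  by rewrite absv_distC; exact: NP.
by apply/cvg_ex; exists l; exact/cvgn_nullP.
Qed.

Lemma series_limP u : null u -> null (fun k => limn (series u) - series u k).
Proof. by move/series_cvgP => cu; apply/cvgn_nullP. Qed.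

Lemma absv_lim_le u (B : R) : null u -> (forall k, absv (u k) <= B) ->
  absv (limn (series u)) <= B.
Proof.
move=> u0 uB; have B0 : 0 <= B := le_trans (absv_ge0 _) (uB 0%N).
apply/ler_addgt0Pr => e e0.
have [N _ /(_ N (leqnn _)) /= NP] := series_limP u0 e0.
rewrite -(subrK (series u N) (limn _)); apply: absvD_le.
  by rewrite (le_trans (ltW NP))// lerDr.
rewrite (@le_trans _ _ B) ?lerDl ?(ltW e0)// /series /=.
elim/big_ind: _ => //; first by rewrite absv0.
by move=> x y; exact: absvD_le.
Qed.

Definition znull a :=
  null (fun k => a (Posz k)) /\ null (fun k => a (Negz k)).

Lemma zcvgP a : zcvg a <-> znull a.
Proof. by split=> -[/series_cvgP ? /series_cvgP ?]. Qed.

Definition zpart a N : C :=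
  series (fun k => a (Posz k)) N + series (fun k => a (Negz k)) N.

Lemma zsumP a (s : C) : znull a -> null (fun k => s - zpart a k) -> zsum a = s.
Proof.
move=> [a1 a2] sP; apply/esym/eqP; rewrite -subr_eq0; apply/eqP/null_const.
have := nullD sP (nullN (nullD (series_limP a1) (series_limP a2))).
apply: eq_null => k; rewrite /zpart /zsum.
by rewrite [X in _ - X]addrACA -opprD opprB addrA subrK.
Qed.

Lemma zsum_part a : znull a -> null (fun k => zsum a - zpart a k).
Proof.
move=> [a1 a2]; have := nullD (series_limP a1) (series_limP a2).
by apply: eq_null => k; rewrite addrACA -opprD.
Qed.

Lemma znullD a b : znull a -> znull b -> znull (fun n => a n + b n).
Proof. by move=> [? ?] [? ?]; split; exact: nullD. Qed.

Lemma zsumD a b : znull a -> znull b ->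
  zsum (fun n => a n + b n) = zsum a + zsum b.
Proof.
move=> a0 b0; apply: zsumP; first exact: znullD.
apply: eq_null (nullD (zsum_part a0) (zsum_part b0)) => k.
rewrite addrACA -opprD; congr (_ - _).
by rewrite /zpart /series /= addrACA -!big_split.
Qed.

Lemma znullM (c : C) a : znull a -> znull (fun n => c * a n).
Proof. by move=> [? ?]; split; exact: nullM. Qed.

Lemma zsumM (c : C) a : znull a -> zsum (fun n => c * a n) = c * zsum a.
Proof.
move=> a0; apply: zsumP; first exact: znullM.
apply: eq_null (nullM c (zsum_part a0)) => k.
by rewrite mulrBr; congr (_ - _); rewrite /zpart /series /= mulrDr !mulr_sumr.
Qed.

Lemma NegzS1 (k : nat) : Negz k.+1 + 1 = Negz k.
Proof. by rewrite !NegzE -[k.+2]addn1 PoszD opprD subrK. Qed.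

Lemma PoszS1 (k : nat) : Posz k + 1 = Posz k.+1.
Proof. by rewrite -[k.+1]addn1 PoszD. Qed.

Lemma znullS a : znull a <-> znull (fun n => a (n + 1)).
Proof.
split=> -[a1 a2]; split.
- by apply: eq_null (nullS a1) => k; rewrite PoszS1.
- by apply/nullSV/(eq_null _ a2) => k; rewrite NegzS1.
- by apply/nullSV/(eq_null _ a1) => k; rewrite PoszS1.
- by apply: eq_null (nullS a2) => k; rewrite NegzS1.
Qed.

Lemma zpartS a (k : nat) :
  zpart (fun n => a (n + 1)) k.+1 = zpart a k.+1 + (a (Posz k.+1) - a (Negz k)).
Proof.
elim: k => [|k IH].
  rewrite /zpart /series /= !big_nat1 add0r.
  have -> : Negz 0 + 1 = 0 by [].
  by rewrite addrC [a 1 - _]addrC addrA addrK.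
have zpart_recr b m : zpart b m.+1 = zpart b m + (b (Posz m) + b (Negz m)).
  by rewrite /zpart /series /= !big_nat_recr//= addrACA.
rewrite zpart_recr IH [zpart a k.+2]zpart_recr /= NegzS1 PoszS1 -!addrA; congr (_ + (_ + _)).
transitivity (a k.+1 + a k.+2); congr (_ + _); first by rewrite [LHS]addrC addrK.
by rewrite [RHS]addrC subrK.
Qed.

Lemma zsumS a : znull a -> zsum (fun n => a (n + 1)) = zsum a.
Proof.
move=> a0; apply: zsumP; first exact: (znullS a).1.
have [a1 a2] := a0; apply: nullSV.
apply: eq_null (nullD (nullS (zsum_part a0)) (nullN (nullD (nullS a1) (nullN a2)))) => k.
by rewrite zpartS [in RHS]opprD addrA.
Qed.

End two_sided_series.

Section tau_series.
Context {R : realType} {F : finFieldType} (C : nonArchClosedField R F).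

(* The ring of formal sums \sum_(n in Z) a_n tau^n that converge at every point
   of C. *)
Record tauSeries := TauSeries {
  coef :> int -> C ;
  coefP : forall z : C, zcvg (fun n => coef n * qpow n z)
}.

End tau_series.

Section tau_series_theory.
Context {R : realType} {F : finFieldType} {C : nonArchClosedField R F}.
Implicit Types (a b : int -> C) (f g : tauSeries C) (x y z : C).

Local Notation q := #|F|.

Definition tau_eval a z : C := zsum (fun n => a n * qpow n z).

(* The coefficient of tau^n in (\sum_i a_i tau^i) o (\sum_j b_j tau^j), the
   sum over i + j = n being indexed by i. *)
Definition tau_comp a b : int -> C :=
  fun n => zsum (fun i => a i * qpow i (b (n - i))).

Definition tau_const (c : C) : int -> C := fun n => if n == 0 then c else 0.

Definition one_sub_tau : int -> C :=
  fun n => if n == 0 then 1 else if n == 1 then -1 else 0.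

(* \sum_m a_m^(1/q^m) tau^(-m), reindexed by n = -m. *)
Definition adj_coef a : int -> C := fun n => qpow n (a (- n)).

Lemma tauSeries_eq f g : f =1 g -> f = g.
Proof.
case: f g => [a aP] [b bP] /= /funext ab; move: aP bP; rewrite ab => aP bP.
by rewrite (Prop_irrelevance aP bP).
Qed.

Lemma tau_null f z : znull (fun n => f n * qpow n z).
Proof. exact/zcvgP/coefP. Qed.

Lemma coef_null f : znull f.
Proof.
have [f1 f2] := tau_null f 1; split; [apply: eq_null f1|apply: eq_null f2] => k.
  by rewrite qpow1 mulr1.
by rewrite qpow1 mulr1.
Qed.

Lemma tau_evalD f x y : tau_eval f (x + y) = tau_eval f x + tau_eval f y.
Proof.
rewrite /tau_eval -zsumD; [|exact: tau_null..].
by congr zsum; apply/funext => n; rewrite qpowD mulrDr.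
Qed.

Lemma tau_evalZ f (c : F) x : tau_eval f (Femb c * x) = Femb c * tau_eval f x.
Proof.
rewrite /tau_eval -zsumM; last exact: tau_null.
by congr zsum; apply/funext => n; rewrite qpowM qpow_Femb mulrCA.
Qed.

Lemma tau_eval0 f : tau_eval f 0 = 0.
Proof. by have := tau_evalZ f 0 0; rewrite rmorph0 !mul0r. Qed.

Lemma absv_unbounded x (B : R) : 1 < absv x -> exists y : C, B <= absv y.
Proof.
move=> x1.
pose b := Num.max 1 B; have b0 : 0 < b by rewrite lt_max ltr01.
have x0 : 0 < absv x by rewrite (lt_trans ltr01).
have xV1 : `|(absv x)^-1| < 1 by rewrite ger0_norm ?invr_ge0 ?absv_ge0// invf_lt1.
have bV0 : 0 < b^-1 by rewrite invr_gt0.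
have /cvgr0Pnorm_lt/(_ _ bV0)[N _ /(_ N (leqnn _))] /= := cvg_expr xV1.
rewrite exprVn ger0_norm ?invr_ge0 ?exprn_ge0 ?absv_ge0//.
rewrite ltf_pV2 ?posrE ?exprn_gt0// => /ltW bx.
exists (x ^+ N); rewrite absvX (le_trans _ bx)// le_max lexx orbT//.
Qed.

Lemma adj_coefP f z : zcvg (fun n => adj_coef f n * qpow n z).
Proof.
apply/zcvgP; have [f1 f2] := coef_null f; split.
  apply: nullSV => e e0.
  have e0' : 0 < Num.min 1 e by rewrite lt_min ltr01.
  have [N _ NP] := nullM z f2 e0'.
  exists N => // k /NP /=; rewrite lt_min => /andP[w1 we].
  rewrite /adj_coef -qpowM -NegzE mulrC qpow_nat absvX (le_lt_trans _ we)//.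
  by rewrite ler_iXnr ?absv_ge0 ?qX_gt0// ltW.
move=> e e0.
have [[x x1]|triv] := pselect (exists x : C, 1 < absv x).
  pose Z := Num.max 1 (absv z).
  have Z1 : 1 <= Z by rewrite le_max lexx.
  have Z0 : 0 < Z by rewrite (lt_le_trans ltr01).
  have [t tZ] := absv_unbounded (Z / e) x1.
  have [+ _] := tau_null f t => /nullS /(_ 1 ltr01)[N _ NP].
  exists N => // k /NP /=; rewrite qpow_nat absvM absvX => ft.
  rewrite /adj_coef -qpowM; apply: absv_qpowN_lt => //.
  have -> : - Negz k = k.+1 by rewrite NegzE opprK.
  rewrite absvM; set m := (q ^ k.+1)%N in ft *.
  have zZ : absv z <= Z ^+ m.
    by rewrite (@le_trans _ _ Z) ?le_max ?lexx ?orbT// ler_eXnr// qX_gt0.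
  rewrite (le_lt_trans (ler_wpM2l (absv_ge0 _) zZ))//.
  rewrite -[Z](divfK (lt0r_neq0 e0)) exprMn mulrA -[ltRHS]mul1r.
  rewrite ltr_pM2r ?exprn_gt0// (le_lt_trans _ ft)//.
  rewrite ler_wpM2l ?absv_ge0// lerXn2r ?nnegrE ?absv_ge0//.
  by rewrite divr_ge0// ltW.
have [N _ NP] := nullS f1 ltr01.
exists N => // k /NP /= fk1.
suff -> : adj_coef f (Negz k) = 0 by rewrite mul0r absv0.
rewrite /adj_coef NegzE opprK; suff -> : f k.+1 = 0 by rewrite qpow0.
apply: contrapT => /eqP fk0; apply: triv; exists (f k.+1)^-1.
have fp : 0 < absv (f k.+1) by rewrite lt_neqAle absv_ge0 eq_sym absv_eq0 fk0.
by rewrite -(ltr_pM2l fp) mulr1 -absvM divff// absv1.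
Qed.

Definition adj f : tauSeries C := TauSeries (adj_coefP f).

End tau_series_theory.

Section pairing_theory.
Context {R : realType} {F : finFieldType} {C : nonArchClosedField R F}.
Implicit Types (a b : int -> C) (u : nat -> C) (f g : tauSeries C) (x y z : C).

Local Notation q := #|F|.

Lemma null0 : null (fun=> 0 : C).
Proof. by move=> e e0; exists 0%N => // k _; rewrite /= absv0. Qed.

Lemma null_near u v N : null u -> (forall k, (N <= k)%N -> u k = v k) -> null v.
Proof.
move=> u0 uv e e0; have [M _ MP] := u0 e e0.
exists (maxn N M) => // k; rewrite /= geq_max => /andP[Nk Mk].
by rewrite -uv//; exact: MP.
Qed.

Lemma series_supp1 u (m k : nat) : (forall i, i != m -> u i = 0) ->
  series u k = if (m < k)%N then u m else 0.
Proof.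
move=> um; elim: k => [|k IH]; first by rewrite ltn0 /series /= big_nil.
rewrite seriesSr IH ltnS; case: (ltngtP m k) => [mk|km|<-].
- by rewrite (um k) ?addr0// gtn_eqF.
- by rewrite (um k) ?addr0// ltn_eqF.
- by rewrite add0r.
Qed.

Lemma znull_supp1 a n : (forall i, i != n -> a i = 0) -> znull a.
Proof.
case: n => m am; split.
- apply: (@null_near (fun=> 0) _ m.+1); first exact: null0.
  by move=> k mk; rewrite am// eqz_nat gtn_eqF.
- by apply: eq_null null0 => k; rewrite am.
- by apply: eq_null null0 => k; rewrite am.
- apply: (@null_near (fun=> 0) _ m.+1); first exact: null0.
  by move=> k mk; rewrite am// !NegzE eqr_opp eqz_nat eqSS gtn_eqF.
Qed.

Lemma zsum_supp1 a n : (forall i, i != n -> a i = 0) -> zsum a = a n.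
Proof.
move=> an; apply: zsumP; first exact: znull_supp1 an.
case: n an => m am.
  apply: (@null_near (fun=> 0) _ m.+1); first exact: null0.
  move=> k mk; rewrite /zpart (@series_supp1 _ m) => [|i im]; last first.
    by rewrite am// eqz_nat.
  have -> : series (fun i => a (Negz i)) k = 0.
    by rewrite /series /= big1// => i _; rewrite am.
  by rewrite mk addr0 subrr.
apply: (@null_near (fun=> 0) _ m.+1); first exact: null0.
move=> k mk; rewrite /zpart [X in _ - (_ + X)](@series_supp1 _ m) => [|i im]; last first.
  by rewrite am// !NegzE eqr_opp eqz_nat eqSS.
have -> : series (fun i => a (Posz i)) k = 0.
  by rewrite /series /= big1// => i _; rewrite am.
by rewrite mk add0r subrr.
Qed.

Lemma tau_comp_const a x n : tau_comp a (tau_const x) n = a n * qpow n x.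
Proof.
rewrite /tau_comp (@zsum_supp1 _ n) => [|i ni]; first by rewrite subrr /tau_const eqxx.
by rewrite /tau_const subr_eq0 eq_sym (negbTE ni) qpow0 mulr0.
Qed.

Lemma tau_comp_one_sub a n : tau_comp a (@one_sub_tau _ _ C) n = a n - a (n - 1).
Proof.
pose a1 i := if i == n then a n else 0.
pose a2 i := if i == n - 1 then - a (n - 1) else 0.
have a1P i : i != n -> a1 i = 0 by rewrite /a1 => /negbTE ->.
have a2P i : i != n - 1 -> a2 i = 0 by rewrite /a2 => /negbTE ->.
have -> : tau_comp a one_sub_tau n = zsum (fun i => a1 i + a2 i).
  rewrite /tau_comp; congr zsum; apply/funext => i.
  rewrite /one_sub_tau /a1 /a2 subr_eq0 eq_sym.
  have -> : (n - i == 1) = (i == n - 1).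
    by rewrite subr_eq addrC -subr_eq eq_sym.
  have [->|ni] := eqVneq i n.
    rewrite qpow1 mulr1 -[eqbLHS]addr0 (inj_eq (addrI _)) eq_sym oppr_eq0.
    by rewrite addr0.
  case: eqVneq => [->|_]; last by rewrite qpow0 mulr0 addr0.
  by rewrite qpowN qpow1 mulrN1 add0r.
rewrite zsumD; [|exact: znull_supp1 a1P|exact: znull_supp1 a2P].
by rewrite (zsum_supp1 a1P) (zsum_supp1 a2P) /a1 /a2 !eqxx.
Qed.

Lemma tau_quoP a b x : tau_comp a (tau_const x) = tau_comp b one_sub_tau <->
  forall n, a n * qpow n x = b n - b (n - 1).
Proof.
split=> [ab n|ab].
  by have := congr1 (@^~ n) ab; rewrite tau_comp_const tau_comp_one_sub.
by apply/funext => n; rewrite tau_comp_const tau_comp_one_sub.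
Qed.

Lemma znull_shift a n : znull a -> znull (fun i => a (i + n)).
Proof.
move=> a0; elim/int_rec: n => [|n IH|n IH].
- by under eq_fun do rewrite addr0.
- have := (znullS _).1 IH; congr znull; apply/funext => i.
  by rewrite -PoszS1 -addrA [1 + _]addrC.
- apply/znullS; move: IH; congr znull; apply/funext => i.
  by rewrite -PoszS1 opprD [- _ - 1]addrC addrA addrK.
Qed.

Lemma null_up a n : znull a -> null (fun k => a (n + k%:Z)).
Proof.
by move=> /(@znull_shift _ n)[+ _]; apply: eq_null => k; rewrite addrC.
Qed.

Lemma null_down a n : znull a -> null (fun k => a (n - k%:Z)).
Proof.
move=> /(@znull_shift _ n)[_ a0]; apply/nullSV/(eq_null _ a0) => k.
by rewrite NegzE addrC.
Qed.

Lemma limn_seriesS u : null u ->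
  limn (series u) = u 0%N + limn (series (fun k => u k.+1)).
Proof.
move=> u0; apply: limn_nullP; apply: nullSV.
apply: eq_null (series_limP (nullS u0)) => k.
have -> : series u k.+1 = u 0%N + series (fun k => u k.+1) k.
  by rewrite /series /= big_nat_recl.
by rewrite opprD addrACA subrr add0r.
Qed.

Lemma int_const (T : Type) (h : int -> T) :
  (forall n, h n = h (n - 1)) -> forall n, h n = h 0.
Proof.
move=> hS; elim/int_rec => // n IH; first by rewrite hS -PoszS1 addrK.
by rewrite -IH [in RHS]hS -PoszS1 opprD.
Qed.

Section quotient.
Variables (f : tauSeries C) (x : C).
Hypothesis fx0 : tau_eval f x = 0.

Let c n := f n * qpow n x.
Let c0 : znull c. Proof. exact: tau_null. Qed.
Let G n := limn (series (fun j => c (n - j%:Z))).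
Let H n := limn (series (fun j => c (n + 1 + j%:Z))).

Let GS n : G n - G (n - 1) = c n.
Proof.
rewrite /G limn_seriesS; last exact: null_down.
rewrite subr0 (_ : (fun k => c (n - k.+1%:Z)) = (fun k => c (n - 1 - k%:Z))) ?addrK//.
by apply/funext => k; rewrite -PoszS1 opprD [- _ - 1]addrC addrA.
Qed.

Let HS n : H (n - 1) - H n = c n.
Proof.
rewrite /H (limn_seriesS (null_up (n - 1 + 1) c0)) subrK addr0.
rewrite (_ : (fun k => c (n + k.+1%:Z)) = (fun k => c (n + 1 + k%:Z))) ?addrK//.
by apply/funext => k; rewrite -PoszS1 [_ + 1]addrC addrA.
Qed.

Let GH n : G n = - H n.
Proof.
suff GHn m : G m + H m = 0 by apply/eqP; rewrite -subr_eq0 opprK GHn.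
pose h k := G k + H k.
have hS k : h k = h (k - 1).
  rewrite /h -[G k](subrK (G (k - 1))) GS -(HS k) [X in X + _]addrC.
  by rewrite -addrA subrK.
have -> : G m + H m = h (-1) by rewrite (int_const hS (-1)) -(int_const hS m).
have e1 : (fun j => c (-1 + 1 + j%:Z)) = (fun k => f (Posz k) * qpow (Posz k) x).
  by apply/funext => k; rewrite addNr add0r.
have e2 : (fun j => c (-1 - j%:Z)) = (fun k => f (Negz k) * qpow (Negz k) x).
  by apply/funext => k; rewrite /c NegzE -PoszS1 opprD [_ - 1]addrC.
by rewrite /h -[RHS]fx0 /tau_eval /zsum [LHS]addrC /H /G e1 e2.
Qed.

Let GP z : zcvg (fun n => G n * qpow n z).
Proof.
apply/zcvgP; pose z' := if 1 <= absv z then z else 1; pose Z := absv z'.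
have [Z1 zZ] : 1 <= Z /\ absv z <= Z.
  rewrite /Z /z'; case: ifPn => [//|]; rewrite absv1 -ltNge => /ltW z1.
  by split.
have Z0 : 0 < Z by rewrite (lt_le_trans ltr01).
split=> e e0.
  have [fz _] := tau_null f (x * z').
  have e20 : 0 < e / 2 by rewrite divr_gt0.
  have [N _ NP] := fz _ e20; exists N => // k /= Nk.
  have T0 : 0 < Z ^+ (q ^ k) by rewrite exprn_gt0.
  rewrite absvM qpow_nat absvX.
  have zT : absv z ^+ (q ^ k) <= Z ^+ (q ^ k).
    by rewrite lerXn2r ?nnegrE ?absv_ge0// ltW.
  apply: (@le_lt_trans _ _ (e / 2)); last by rewrite ltr_pdivrMr// ltr_pMr// ltr1n.
  apply: le_trans (ler_wpM2l (absv_ge0 _) zT) _.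
  rewrite -ler_pdivlMr// GH absvN; apply: absv_lim_le; first exact: null_up.
  move=> j; rewrite ler_pdivlMr//.
  have kj : k%:Z + 1 + j%:Z = (k + 1 + j)%N by rewrite !PoszD.
  rewrite kj; have {NP} := NP (k + 1 + j)%N.
  rewrite /= -addnA (leq_trans Nk) ?leq_addr// => /(_ isT) /ltW.
  apply: le_trans; rewrite /c qpowM mulrA [leRHS]absvM.
  rewrite ler_wpM2l ?absv_ge0// qpow_nat absvX.
  by rewrite ler_weXn2l// leq_pexp2l ?leq_addr// (ltn_trans _ (finNzRing_gt1 F)).
have e20 : 0 < e / 2 / Z by rewrite !divr_gt0.
have [_ cN] := c0; have [N _ NP] := cN _ e20; exists N => // k /= Nk.
rewrite absvM; apply: (@le_lt_trans _ _ (e / 2)); last first.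
  by rewrite ltr_pdivrMr// ltr_pMr// ltr1n.
rewrite -[leRHS](divfK (lt0r_neq0 Z0)) ler_pM ?absv_ge0//; last first.
  exact: absv_qpowN_le.
apply: absv_lim_le; first exact: null_down.
move=> j; apply/ltW; have -> : Negz k - j%:Z = Negz (k + j)%N.
  by rewrite !NegzE -opprD -PoszD addSn.
by apply: NP; rewrite /= (leq_trans Nk)// leq_addr.
Qed.

Lemma tau_quo_ex : exists g, tau_comp f (tau_const x) = tau_comp g one_sub_tau.
Proof. by exists (TauSeries GP); apply/tau_quoP => n; rewrite GS. Qed.

End quotient.

Lemma tau_quo_inj (g h : tauSeries C) :
  tau_comp g one_sub_tau = tau_comp h one_sub_tau -> g = h.
Proof.
move=> gh; apply: tauSeries_eq => n; apply/eqP; rewrite -subr_eq0; apply/eqP.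
have dS k : g k - h k = g (k - 1) - h (k - 1).
  have := congr1 (@^~ k) gh; rewrite !tau_comp_one_sub => /eqP.
  rewrite subr_eq => /eqP ->.
  by rewrite [LHS]addrAC [h k - _ - _]addrAC subrr sub0r addrC.
apply: null_const.
have [_ gN] := coef_null g; have [_ hN] := coef_null h.
apply: eq_null (nullD gN (nullN hN)) => k.
by rewrite (int_const dS) -(int_const dS n).
Qed.

Lemma tau_quo_uniq f x : tau_eval f x = 0 ->
  exists! g, tau_comp f (tau_const x) = tau_comp g one_sub_tau.
Proof.
move=> /tau_quo_ex[g gP]; exists g; split => // h; rewrite gP.
exact: tau_quo_inj.
Qed.

Lemma null_qpow1 u : null u -> null (fun k => qpow 1 (u k)).
Proof.
move=> u0 e e0; have e0' : 0 < Num.min 1 e by rewrite lt_min ltr01.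
have [N _ NP] := u0 _ e0'; exists N => // k /NP /=.
rewrite lt_min => /andP[u1 ue]; rewrite qpow_nat absvX (le_lt_trans _ ue)//.
by rewrite ler_iXnr ?absv_ge0 ?qX_gt0// ltW.
Qed.

Lemma znull_qpow1 a : znull a -> znull (fun n => qpow 1 (a n)).
Proof. by move=> [? ?]; split; exact: null_qpow1. Qed.

Lemma zsum_qpow1 a : znull a -> zsum (fun n => qpow 1 (a n)) = qpow 1 (zsum a).
Proof.
move=> a0; apply: zsumP; first exact: znull_qpow1.
apply: eq_null (null_qpow1 (zsum_part a0)) => k.
rewrite qpowD qpowN; congr (_ - _); rewrite /zpart /series /= qpowD.
by congr (_ + _); apply: (big_morph _ (qpowD 1) (qpow0 1)).
Qed.

Lemma tau_quo_Fq f g x y :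
  tau_comp f (tau_const x) = tau_comp g one_sub_tau ->
  tau_eval (adj f) y = 0 ->
  exists c : F, Femb c = tau_eval (adj g) y.
Proof.
move=> /tau_quoP fg fy; apply: Femb_fixed; apply/eqP; rewrite -subr_eq0.
set S := tau_eval _ _; rewrite -qpow1z /S.
have A0 := tau_null (adj g) y.
rewrite /tau_eval -zsum_qpow1// -[X in _ - X]zsumS// -mulN1r -zsumM; last first.
  exact: (znullS _).1 A0.
rewrite -zsumD; [|exact: znull_qpow1|exact/znullM/((znullS _).1 A0)].
apply/eqP; transitivity (zsum (fun n => qpow 1 x * qpow 1 (adj f n * qpow n y))).
  congr zsum; apply/funext => n /=.
  rewrite /adj_coef -!qpowM -!qpow_comp mulN1r -qpowN [1 + n]addrC -qpowD.
  rewrite -mulNr -mulrDl opprD -fg.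
  rewrite mulrAC [x * _]mulrC !qpowM -!qpow_comp [1 + n]addrC.
  by congr (_ * qpow _ _); rewrite addrAC subrr add0r.
have B0 := tau_null (adj f) y.
rewrite zsumM; last exact: znull_qpow1.
by rewrite zsum_qpow1// -/(tau_eval (adj f) y) fy qpow0 mulr0.
Qed.

End pairing_theory.

Section kernel.
Context {R : realType} {F : finFieldType} {C : nonArchClosedField R F}.
Variable f : tauSeries C.

Definition ker_set : set C := [set z | tau_eval f z = 0].

Definition ker : Type := ker_set.

HB.instance Definition _ := Topological.copy ker (set_type ker_set).

Definition ker_val (x : ker) : C := set_val x.

Lemma ker_valP (x : ker) : tau_eval f (ker_val x) = 0.
Proof. exact: set_valP x. Qed.

Lemma ker_val_inj : injective ker_val.
Proof. exact: val_inj. Qed.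

Lemma ker_zero_proof : 0 \in ker_set.
Proof. by apply/mem_set; exact: tau_eval0. Qed.

Lemma ker_add_proof x y : ker_val x + ker_val y \in ker_set.
Proof. by apply/mem_set; rewrite /ker_set /= tau_evalD !ker_valP addr0. Qed.

Lemma ker_scale_proof (c : F) x : Femb c * ker_val x \in ker_set.
Proof. by apply/mem_set; rewrite /ker_set /= tau_evalZ ker_valP mulr0. Qed.

Lemma ker_opp_proof x : - ker_val x \in ker_set.
Proof. by have := ker_scale_proof (-1) x; rewrite rmorphN1 mulN1r. Qed.

Definition ker_zero : ker := SigSub ker_zero_proof.
Definition ker_add (x y : ker) : ker := SigSub (ker_add_proof x y).
Definition ker_opp (x : ker) : ker := SigSub (ker_opp_proof x).
Definition ker_scale (c : F) (x : ker) : ker := SigSub (ker_scale_proof c x).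

Lemma ker_addA : associative ker_add.
Proof. by move=> x y z; apply: ker_val_inj; exact: addrA. Qed.
Lemma ker_addC : commutative ker_add.
Proof. by move=> x y; apply: ker_val_inj; exact: addrC. Qed.
Lemma ker_add0 : left_id ker_zero ker_add.
Proof. by move=> x; apply: ker_val_inj; exact: add0r. Qed.
Lemma ker_addN : left_inverse ker_zero ker_opp ker_add.
Proof. by move=> x; apply: ker_val_inj; exact: addNr. Qed.

HB.instance Definition _ :=
  GRing.isZmodule.Build ker ker_addA ker_addC ker_add0 ker_addN.

Lemma ker_scaleA c d x : ker_scale c (ker_scale d x) = ker_scale (c * d) x.
Proof.
apply: ker_val_inj; rewrite /ker_val !set_valE /= /ker_val !set_valE /=.
by rewrite rmorphM mulrA.
Qed.
Lemma ker_scale1 : left_id 1 ker_scale.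
Proof.
by move=> x; apply: ker_val_inj; rewrite /ker_val set_valE /= rmorph1 mul1r.
Qed.
Lemma ker_scaleDr : right_distributive ker_scale +%R.
Proof. by move=> c x y; apply: ker_val_inj; exact: mulrDr. Qed.
Lemma ker_scaleDl x : {morph ker_scale^~ x : c d / c + d}.
Proof.
move=> c d; apply: ker_val_inj; rewrite /ker_val !set_valE /=.
by rewrite rmorphD mulrDl.
Qed.

HB.instance Definition _ := GRing.Zmodule_isLmodule.Build F ker
  ker_scaleA ker_scale1 ker_scaleDr ker_scaleDl.

End kernel.

Section dual.
Context {R : realType} {F : finFieldType} {C : nonArchClosedField R F}.
Variable f : tauSeries C.

(* Continuous F-linear forms on ker f, F being discrete; as a subset of
   {compact-open, _ -> _} it gets the compact-open topology. *)
Definition dual_set : set {compact-open, ker f -> discrete_topology F} :=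
  [set phi | linear (phi : ker f -> F^o) /\
             continuous (phi : ker f -> discrete_topology F)].

Definition dual : Type := dual_set.

HB.instance Definition _ := Topological.copy dual (set_type dual_set).

Definition dual_fun (phi : dual) : ker f -> F := set_val phi.

Coercion dual_fun : dual >-> Funclass.

Lemma dual_linear (phi : dual) : linear (phi : ker f -> F^o).
Proof. by have [] := set_valP phi. Qed.

Lemma continuous_discreteP (phi : ker f -> F) :
  continuous (phi : ker f -> discrete_topology F) <->
  forall x, \forall y \near x, phi y = phi x.
Proof.
split=> [cphi x|cphi x A].
  by apply: (cphi x [set c | c = phi x]); exact/principal_filterP.
move=> /principal_filterP Ax; have := cphi x; apply: filterS => y /=.
by rewrite /= => ->.
Qed.

Lemma dual_locconst (phi : dual) x : \forall y \near x, phi y = phi x.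
Proof. by have [_ /continuous_discreteP] := set_valP phi; exact. Qed.

Lemma dual_eq (phi psi : dual) : phi =1 psi -> phi = psi.
Proof. by move=> /funext e; apply: val_inj. Qed.

Lemma dual_setP (phi : ker f -> F) : linear (phi : ker f -> F^o) ->
  (forall x, \forall y \near x, phi y = phi x) -> phi \in dual_set.
Proof. by move=> lphi cphi; apply/mem_set; split=> //; exact/continuous_discreteP. Qed.

Lemma dual_zero_proof : (fun=> 0) \in dual_set.
Proof.
apply: dual_setP => [c x y|x]; first by rewrite scaler0 addr0.
by apply: filterE.
Qed.

Lemma dual_add_proof (phi psi : dual) : (fun x => phi x + psi x) \in dual_set.
Proof.
apply: dual_setP => [c x y|x].
  by rewrite !dual_linear scalerDr addrACA.
have := dual_locconst psi x; have := dual_locconst phi x.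
by apply: filterS2 => y -> ->.
Qed.

Lemma dual_scale_proof (c : F) (phi : dual) : (fun x => c * phi x) \in dual_set.
Proof.
apply: dual_setP => [d x y|x].
  by rewrite dual_linear mulrDr; congr (_ + _); exact: mulrCA.
by have := dual_locconst phi x; apply: filterS => y ->.
Qed.

Lemma dual_opp_proof (phi : dual) : (fun x => - phi x) \in dual_set.
Proof.
by have := dual_scale_proof (-1) phi; under eq_fun do rewrite mulN1r.
Qed.

Definition dual_zero : dual := SigSub dual_zero_proof.
Definition dual_add (phi psi : dual) : dual := SigSub (dual_add_proof phi psi).
Definition dual_opp (phi : dual) : dual := SigSub (dual_opp_proof phi).
Definition dual_scale (c : F) (phi : dual) : dual :=
  SigSub (dual_scale_proof c phi).

Lemma dual_addA : associative dual_add.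
Proof. by move=> x y z; apply: dual_eq => w; exact: addrA. Qed.
Lemma dual_addC : commutative dual_add.
Proof. by move=> x y; apply: dual_eq => w; exact: addrC. Qed.
Lemma dual_add0 : left_id dual_zero dual_add.
Proof. by move=> x; apply: dual_eq => w; exact: add0r. Qed.
Lemma dual_addN : left_inverse dual_zero dual_opp dual_add.
Proof. by move=> x; apply: dual_eq => w; exact: addNr. Qed.

HB.instance Definition _ :=
  GRing.isZmodule.Build dual dual_addA dual_addC dual_add0 dual_addN.

Lemma dual_scaleA c d phi :
  dual_scale c (dual_scale d phi) = dual_scale (c * d) phi.
Proof. by apply: dual_eq => w; exact: mulrA. Qed.
Lemma dual_scale1 : left_id 1 dual_scale.
Proof. by move=> x; apply: dual_eq => w; exact: mul1r. Qed.
Lemma dual_scaleDr : right_distributive dual_scale +%R.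
Proof. by move=> c x y; apply: dual_eq => w; exact: mulrDr. Qed.
Lemma dual_scaleDl phi : {morph dual_scale^~ phi : c d / c + d}.
Proof. by move=> c d; apply: dual_eq => w; exact: mulrDl. Qed.

HB.instance Definition _ := GRing.Zmodule_isLmodule.Build F dual
  dual_scaleA dual_scale1 dual_scaleDr dual_scaleDl.

End dual.

Section pairing.
Context {R : realType} {F : finFieldType} {C : nonArchClosedField R F}.
Variable f : tauSeries C.

(* The g with f o alpha = g o (1 - tau); it is unique by tau_quo_uniq. *)
Definition tau_quo (alpha : ker f) : tauSeries C :=
  sval (cid (tau_quo_ex (ker_valP alpha))).

Lemma tau_quoE (alpha : ker f) :
  tau_comp f (tau_const (ker_val alpha)) = tau_comp (tau_quo alpha) one_sub_tau.
Proof. exact: svalP (cid (tau_quo_ex (ker_valP alpha))). Qed.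

(* The element of F whose image in C is g^*(beta), see pairingE. *)
Definition pairing (alpha : ker f) (beta : ker (adj f)) : F :=
  sval (cid (tau_quo_Fq (tau_quoE alpha) (ker_valP beta))).

Lemma pairingE (alpha : ker f) (beta : ker (adj f)) :
  Femb (pairing alpha beta) = tau_eval (adj (tau_quo alpha)) (ker_val beta).
Proof. exact: svalP (cid (tau_quo_Fq (tau_quoE alpha) (ker_valP beta))). Qed.

End pairing.

Definition homeomorphism (X Y : topologicalType) (h : X -> Y) : Prop :=
  continuous h /\
  exists k : Y -> X, [/\ cancel h k, cancel k h & continuous k].

(* Main.v *)
Require Import Defs.
From mathcomp Require Import all_boot all_order all_algebra all_field.
From mathcomp Require Import ring.
From mathcomp Require Import all_classical all_reals all_analysis.

(** Let [f o alpha = g o (1 - tau)] with [alpha] in [ker f]. Taking adjoints,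
    [f^* (beta) = 0] if and only if [g^* (beta)] lies in [F_q], and then
    [g^* (beta)] is the pairing of [alpha] and [beta]; so non-degeneracy amounts
    to solving [g^* (beta) = 1]. A nonzero series [f] is surjective with control
    on the solution: [f (x) = w] has a solution with [|a_n x^(q^n)| <= |w|] for
    all [n], obtained by correcting successively the least root of truncations,
    which are polynomials. Applied to [g^*], this bounds [beta] in terms of
    [alpha]. The same statement for truncations shows that balls of [ker f] are
    compact, and the pairing is antisymmetric under [f <-> f^*]. Representing a
    continuous form is then a compactness argument reducing to duality of
    finite-dimensional spaces. *)

Set Implicit Arguments.
Unset Strict Implicit.
Unset Printing Implicit Defensive.

Import Order.TTheory GRing.Theory Num.Theory.

Local Open Scope classical_set_scope.
Local Open Scope ring_scope.

(** * Ultrametric estimates for series over the integers and for roots of polynomials *)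

Section absolute_value_theory.
Context {R : realType} {F : finFieldType} {C : nonArchClosedField R F}.
Implicit Types (x y z w : C) (f : tauSeries C) (u : nat -> C).

Local Notation q := #|F|.

Lemma absv_gt0 x : (0 < absv x) = (x != 0).
Proof. by rewrite lt_neqAle absv_ge0 eq_sym absv_eq0 andbT. Qed.

(** By [c ^+ q.-1 = 1] the absolute value is a nonnegative real root of unity. *)
Lemma absv_Femb (c : F) : c != 0 -> absv (Femb c : C) = 1.
Proof.
move=> c0; apply/eqP; rewrite -(@pexpr_eq1 _ _ q.-1) ?absv_ge0//; last first.
  by rewrite -ltnS prednK ?finNzRing_gt1// (ltn_trans _ (finNzRing_gt1 F)).
rewrite -absvX -rmorphXn; suff -> : c ^+ q.-1 = 1 by rewrite rmorph1 absv1.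
apply: (mulfI c0); rewrite -exprS mulr1 prednK ?expf_card//.
by rewrite (ltn_trans _ (finNzRing_gt1 F)).
Qed.

Lemma ler_absv_qpow n x y :
  (absv (qpow n x) <= absv (qpow n y)) = (absv x <= absv y).
Proof.
case: n => k; first by rewrite !qpow_nat !absvX ler_pXn2r ?qX_gt0// nnegrE absv_ge0.
by rewrite -(absv_qpowN k x) -(absv_qpowN k y) ler_pXn2r ?qX_gt0// nnegrE absv_ge0.
Qed.

Lemma absv_qpow_lt1 n x : (absv (qpow n x) < 1) = (absv x < 1).
Proof. by have := ler_absv_qpow n 1 x; rewrite qpow1 absv1 !ltNge => ->. Qed.

Lemma absv_qpow_le1 n x : (absv (qpow n x) <= 1) = (absv x <= 1).
Proof. by have := ler_absv_qpow n x 1; rewrite qpow1 absv1. Qed.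

(** The strict bound survives the limit because some partial sum already lies within [e] of it. *)
Lemma absv_lim_lt u (e : R) : null u -> (forall k, absv (u k) < e) ->
  absv (limn (series u)) < e.
Proof.
move=> u0 ue; have e0 : 0 < e := le_lt_trans (absv_ge0 _) (ue 0%N).
have [N _ /(_ N (leqnn _)) /= NP] := series_limP u0 e0.
rewrite -(subrK (series u N) (limn _)); apply: absvD_lt => //.
by rewrite /series /=; exact: absv_sum_lt.
Qed.

Lemma absv_zsum_lt (a : int -> C) (e : R) : znull a -> (forall n, absv (a n) < e) ->
  absv (zsum a) < e.
Proof. by move=> [a1 a2] ae; apply: absvD_lt; apply: absv_lim_lt. Qed.

Lemma null_bounded u : null u -> exists B : R, forall k, absv (u k) <= B.
Proof.
move=> /(_ 1 ltr01) [N _ NP].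
exists (\sum_(k < N) absv (u k) + 1) => k; case: (ltnP k N) => kN.
  rewrite (bigD1 (Ordinal kN)) //= -addrA lerDl addr_ge0 ?ler01//.
  by rewrite sumr_ge0// => i _; exact: absv_ge0.
rewrite (le_trans (ltW (NP _ kN)))// lerDr sumr_ge0// => i _; exact: absv_ge0.
Qed.

Lemma znull_bounded (a : int -> C) : znull a ->
  exists B : R, forall n, absv (a n) <= B.
Proof.
move=> [/null_bounded[B1 B1P] /null_bounded[B2 B2P]].
by exists (Num.max B1 B2) => -[k|k]; rewrite le_max ?B1P ?B2P ?orbT.
Qed.

(** Uniformity in [n]: nonnegative exponents have bounded coefficients and do not enlarge [z], very
    negative ones have coefficients below [e], and the finitely many in between are treated one at a
    time. *)
Lemma tau_term_small f (e : R) : 0 < e ->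
  exists2 d : R, 0 < d &
    forall z, absv z < d -> forall n, absv (f n * qpow n z) < e.
Proof.
move=> e0; have [f1 f2] := coef_null f.
have [B BP] := null_bounded f1; have B0 : 0 <= B := le_trans (absv_ge0 _) (BP 0%N).
have [N _ NP] := f2 _ e0.
have [d d0 dP] : exists2 d : R, 0 < d & forall z, absv z < d ->
    forall k, (k < N)%N -> absv (f (Negz k) * qpow (Negz k) z) < e.
  elim: N {NP} => [|N [d d0 dP]]; first by exists 1.
  pose eta := e / (absv (f (Negz N)) + 1).
  have fN0 : 0 < absv (f (Negz N)) + 1 by rewrite ltr_wpDl ?absv_ge0.
  have eta0 : 0 < eta by rewrite divr_gt0.
  exists (Num.min d (eta ^+ (q ^ N.+1))); first by rewrite lt_min d0 exprn_gt0.
  move=> z; rewrite lt_min => /andP[zd zeta] k.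
  rewrite ltnS leq_eqVlt => /predU1P[->|]; last exact: dP.
  rewrite absvM (@le_lt_trans _ _ (absv (f (Negz N)) * eta)) //.
    by rewrite ler_wpM2l ?absv_ge0// ltW// absv_qpowN_lt.
  by rewrite /eta mulrCA gtr_pMr// ltr_pdivrMr// mul1r ltrDl.
have eB : 0 < e / (B + 1) by rewrite divr_gt0// ltr_wpDl.
exists (Num.min d (Num.min 1 (e / (B + 1)))); first by rewrite !lt_min d0 ltr01.
move=> z; rewrite !lt_min => /and3P[zd z1 ze] [k|k].
  rewrite absvM qpow_nat absvX (@le_lt_trans _ _ (B * absv z)) //.
    rewrite ler_pM ?absv_ge0 ?exprn_ge0 ?absv_ge0//.
    by rewrite ler_iXnr ?absv_ge0 ?qX_gt0 ?ltW.
  rewrite ltr_pdivlMr ?ltr_wpDl// in ze.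
  by rewrite (le_lt_trans _ ze)// mulrC ler_wpM2l ?absv_ge0// lerDl.
have [kN|Nk] := ltnP k N; first exact: dP.
rewrite absvM (le_lt_trans _ (NP k Nk))// ler_piMr ?absv_ge0//.
by rewrite absv_qpow_le1 ltW.
Qed.

Lemma tau_eval_small f (e : R) : 0 < e ->
  exists2 d : R, 0 < d & forall z, absv z < d -> absv (tau_eval f z) < e.
Proof.
move=> /(tau_term_small f)[d d0 dP]; exists d => // z /dP zP.
by apply: absv_zsum_lt => //; exact: tau_null.
Qed.

Lemma tau_evalN f z : tau_eval f (- z) = - tau_eval f z.
Proof. by apply/eqP; rewrite -addr_eq0 -tau_evalD addNr tau_eval0. Qed.

Lemma tau_evalB f y z : tau_eval f (y - z) = tau_eval f y - tau_eval f z.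
Proof. by rewrite tau_evalD tau_evalN. Qed.

(** Up to sign this coefficient is a sum of products of all roots but [m], and each omitted root has
    absolute value at least [r]. *)
Lemma absv_coef_prod_XsubC (rs : seq C) (r : R) (m : nat) :
  0 <= r -> (forall x, x \in rs -> r <= absv x) ->
  absv (\prod_(x <- rs) ('X - x%:P))`_m * r ^+ m <=
  absv (\prod_(x <- rs) ('X - x%:P))`_0.
Proof.
move=> r0; elim: rs m => [|x rs IH] m rsP.
  rewrite big_nil !coef1; case: m => [|m] /=; first by rewrite expr0 mulr1.
  by rewrite absv0 mul0r absv_ge0.
have {}IH k : absv (\prod_(x <- rs) ('X - x%:P))`_k * r ^+ k <=
    absv (\prod_(x <- rs) ('X - x%:P))`_0.
  by apply: IH => y yrs; apply: rsP; rewrite inE yrs orbT.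
have rx : r <= absv x by apply: rsP; rewrite inE eqxx.
rewrite big_cons; set Q := \prod_(_ <- _) _ in IH *.
rewrite mulrBl !coefB !coefXM !coefCM /= sub0r absvN absvM.
have rm0 : 0 <= r ^+ m by rewrite exprn_ge0.
have T2 : absv (x * Q`_m) * r ^+ m <= absv x * absv Q`_0.
  by rewrite absvM -mulrA ler_wpM2l ?absv_ge0.
case: m rm0 T2 => [|m] rm0 T2 /=; first by rewrite sub0r absvN.
apply: le_trans (ler_wpM2r rm0 (absvB _ _)) _.
rewrite maxr_pMl// ge_max T2 andbT exprS mulrCA.
by rewrite ler_pM ?mulr_ge0 ?absv_ge0 ?exprn_ge0.
Qed.

(* The root of least absolute value works: the other roots are at least as
   large, which bounds the symmetric functions of the roots by their product. *)
Lemma poly_solve (p : {poly C}) w : p`_0 = 0 -> p != 0 -> w != 0 ->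
  exists2 t, p.[t] = w & forall m, absv (p`_m) * absv t ^+ m <= absv w.
Proof.
move=> p0 pn0 w0; pose Q := p - w%:P.
have Q0 : Q`_0 = - w by rewrite coefB p0 coefC sub0r.
have Qm m : Q`_m.+1 = p`_m.+1 by rewrite coefB coefC subr0.
have [rs Qrs] := closed_field_poly_normal Q.
have Qroot t : t \in rs -> p.[t] = w.
  move=> trs; apply/eqP; rewrite -subr_eq0.
  have -> : p.[t] - w = Q.[t] by rewrite !hornerE.
  rewrite Qrs hornerZ mulf_eq0 horner_prod; apply/orP; right.
  by rewrite prodf_seq_eq0; apply/hasP; exists t => //=; rewrite !hornerE subrr.
have [t trs tP] : exists2 t, t \in rs & forall x, x \in rs -> absv t <= absv x.
  have : rs != [::].
    apply: contraNneq pn0 => rs0.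
    suff : p`_0 = p`_0 /\ forall m, p`_m.+1 = 0.
      by move=> [_ pm]; apply/eqP/polyP => -[|m]; rewrite coef0.
    by split=> // m; rewrite -Qm Qrs rs0 big_nil coefZ coef1 mulr0.
  elim: (rs) => // x s IH _; have [->|/IH[t ts tP]] := eqVneq s [::].
    by exists x; rewrite ?inE// => y; rewrite inE => /eqP ->.
  have [xt|/ltW tx] := leP (absv x) (absv t).
    exists x; rewrite ?inE ?eqxx// => y; rewrite inE => /predU1P[->//|/tP].
    exact: le_trans.
  exists t; rewrite ?inE ?ts ?orbT// => y; rewrite inE => /predU1P[->//|/tP//].
exists t; first exact: Qroot.
have key m : absv Q`_m * absv t ^+ m <= absv w.
  rewrite -[absv w]absvN -Q0 Qrs !coefZ !absvM -mulrA ler_wpM2l ?absv_ge0//.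
  by apply: absv_coef_prod_XsubC; rewrite ?absv_ge0.
by case=> [|m]; rewrite -?Qm// p0 absv0 mul0r absv_ge0.
Qed.

End absolute_value_theory.

(** * Truncation to polynomials, solvability of [f (x) = w] and total boundedness of zeros *)

Section solving.
Context {R : realType} {F : finFieldType} {C : nonArchClosedField R F}.
Implicit Types (x y z w : C) (f : tauSeries C) (n k : int).

Local Notation q := #|F|.

Lemma qpowK n : cancel (@qpow R F C n) (qpow (- n)).
Proof. by move=> x; rewrite -qpow_comp addNr qpow0z. Qed.

Lemma qpowVK n : cancel (@qpow R F C (- n)) (qpow n).
Proof. by move=> x; rewrite -qpow_comp addrN qpow0z. Qed.

Lemma qpow_small n (e : R) : 0 < e ->
  exists2 d : R, 0 < d & forall x, absv (qpow n x) < d -> absv x < e.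
Proof.
case: n => k e0.
  exists (e ^+ (q ^ k)) => [|x]; first by rewrite exprn_gt0.
  by rewrite qpow_nat absvX ltr_pXn2r ?qX_gt0// nnegrE ?absv_ge0// ltW.
exists (Num.min 1 e) => [|x]; first by rewrite lt_min ltr01.
rewrite lt_min => /andP[x1 xe]; rewrite -(absv_qpowN k x) (le_lt_trans _ xe)//.
by rewrite ler_iXnr ?absv_ge0 ?qX_gt0// ltW.
Qed.

(** Turns bounds on terms, which is what solving provides, into bounds on the argument. *)
Lemma coef_small f k (e : R) : f k != 0 -> 0 < e ->
  exists2 d : R, 0 < d & forall x, absv (f k * qpow k x) < d -> absv x < e.
Proof.
rewrite -absv_gt0 => fk0 /(qpow_small k)[d d0 dP].
exists (absv (f k) * d) => [|x]; first exact: mulr_gt0.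
by rewrite absvM ltr_pM2l//; exact: dP.
Qed.

Lemma zpartE (a : int -> C) (N : nat) :
  zpart a N = \sum_(i < N + N) a (i%:Z - N%:Z).
Proof.
rewrite big_split_ord /= addrC /zpart /series /= !big_mkord; congr (_ + _).
  by apply: eq_bigr => i _; rewrite PoszD addrAC subrr add0r.
(* Negative exponents occur in [zpart] in decreasing order, hence the reversal. *)
rewrite [RHS](reindex_inj rev_ord_inj) /=; apply: eq_bigr => i _.
by rewrite -subzn// NegzE addrAC subrr add0r.
Qed.

Lemma zsum_tail (a : int -> C) (N : nat) (e : R) : 0 < e -> znull a ->
  (forall n, (N <= `|n|)%N -> absv (a n) < e) -> absv (zsum a - zpart a N) < e.
Proof.
move=> e0 a0 aN; have [M _ MP] := zsum_part a0 e0.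
have := MP (N + M)%N (leq_addl _ _) => /= {}MP.
rewrite -(subrK (zpart a (N + M)) (zsum a)) -addrA; apply: absvD_lt => //.
rewrite /zpart opprD addrACA; apply: absvD_lt.
  rewrite sub_series_geq ?leq_addr// big_seq_cond; apply: absv_sum_lt => // i.
  by rewrite andbT mem_index_iota => /andP[Ni _]; exact: aN.
rewrite sub_series_geq ?leq_addr// big_seq_cond; apply: absv_sum_lt => // i.
by rewrite andbT mem_index_iota => /andP[Ni _]; apply: aN; rewrite NegzE abszN leqW.
Qed.

Lemma znull_absz (a : int -> C) (e : R) : 0 < e -> znull a ->
  exists N, forall n, (N <= `|n|)%N -> absv (a n) < e.
Proof.
move=> e0 [/(_ e e0)[N1 _ N1P] /(_ e e0)[N2 _ N2P]].
(* [Negz k] has absolute value [k + 1], hence the successor. *)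
exists (maxn N1 N2.+1) => -[k|k]; rewrite geq_max => /andP[Nk Nk'].
  exact: N1P.
by apply: N2P; rewrite NegzE abszN /= in Nk'.
Qed.

(* The sum of the terms of exponent -N, ..., N - 1 is a polynomial in
   z^(1/q^N). *)
Definition trunc_poly f (N : nat) : {poly C} :=
  \sum_(i < N + N) f (i%:Z - N%:Z) *: 'X^(q ^ i).

Lemma trunc_polyE f N z :
  (trunc_poly f N).[qpow (- N%:Z) z] = zpart (fun n => f n * qpow n z) N.
Proof.
rewrite zpartE horner_sum; apply: eq_bigr => i _.
by rewrite hornerZ hornerXn -qpow_nat -qpow_comp.
Qed.

Lemma coef_trunc_poly f N n : (`|n| < N)%N ->
  exists2 i : nat, n = i%:Z - N%:Z & (trunc_poly f N)`_(q ^ i) = f n.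
Proof.
move=> nN; have [i iN ni] : exists2 i : nat, (i < N + N)%N & n = i%:Z - N%:Z.
  case: n nN => k /= kN.
    by exists (k + N)%N; rewrite ?ltn_add2r// PoszD addrK.
  exists (N - k.+1)%N.
    by rewrite (leq_ltn_trans (leq_subr _ _))// -addn1 leq_add2l (leq_trans _ kN).
  by rewrite -subzn 1?ltnW// NegzE addrAC subrr add0r.
exists i => //; rewrite coef_sum (bigD1 (Ordinal iN)) //= coefZ coefXn eqxx mulr1.
rewrite big1 ?addr0 -?ni// => j ji; rewrite coefZ coefXn eqn_exp2l ?finNzRing_gt1//.
by rewrite eq_sym -[(_ == _)]/(j == Ordinal iN) (negbTE ji) mulr0.
Qed.

Lemma trunc_poly0 f N : (trunc_poly f N)`_0 = 0.
Proof.
rewrite coef_sum big1// => i _; rewrite coefZ coefXn.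
by rewrite eq_sym -leqn0 leqNgt qX_gt0 mulr0.
Qed.

Lemma trunc_poly_neq0 f N k : (`|k| < N)%N -> f k != 0 -> trunc_poly f N != 0.
Proof.
move=> /(coef_trunc_poly f)[i _ fi]; apply: contraNneq => p0.
by rewrite -fi p0 coef0.
Qed.

Lemma trunc_solve f N k w : (`|k| < N)%N -> f k != 0 ->
  exists2 z, zpart (fun n => f n * qpow n z) N = w &
    forall n, (`|n| < N)%N -> absv (f n * qpow n z) <= absv w.
Proof.
move=> kN fk0; have [->|w0] := eqVneq w 0.
  exists 0 => [|n _]; last by rewrite qpow0 mulr0.
  by rewrite zpartE big1// => i _; rewrite qpow0 mulr0.
have [t tw tP] := poly_solve (trunc_poly0 f N) (trunc_poly_neq0 kN fk0) w0.
(* The monomial of degree [q ^ i] at [t] is the term of exponent [i - N] at this point. *)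
exists (qpow N%:Z t); first by rewrite -trunc_polyE qpowK.
move=> n /(coef_trunc_poly f)[i ni fi]; have := tP (q ^ i)%N.
by rewrite fi -absvX -qpow_nat -absvM -qpow_comp ni subrK.
Qed.

Lemma trunc_ker_finite f N k : (`|k| < N)%N -> f k != 0 ->
  exists S : seq C, forall z, zpart (fun n => f n * qpow n z) N = 0 -> z \in S.
Proof.
move=> kN fk0; have p0 := trunc_poly_neq0 kN fk0.
have [rs prs] := closed_field_poly_normal (trunc_poly f N).
exists (map (qpow N%:Z) rs) => z; rewrite -trunc_polyE prs hornerZ => /eqP.
rewrite mulf_eq0 lead_coef_eq0 (negbTE p0) /= horner_prod prodf_seq_eq0.
move=> /hasP[x xrs]; rewrite /= !hornerE subr_eq0 => /eqP zx.
by apply/mapP; exists x => //; rewrite -zx qpowVK.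
Qed.

Lemma tau_term_mono f n x y : absv x <= absv y ->
  absv (f n * qpow n x) <= absv (f n * qpow n y).
Proof. by move=> xy; rewrite !absvM ler_wpM2l ?absv_ge0// ler_absv_qpow. Qed.

Lemma tau_solve_approx f k w : f k != 0 ->
  exists2 z, absv (w - tau_eval f z) <= absv w / 2 &
    forall n, absv (f n * qpow n z) <= absv w.
Proof.
move=> fk0; have [->|w0] := eqVneq w 0.
  exists 0 => [|n]; last by rewrite qpow0 mulr0.
  by rewrite tau_eval0 subrr absv0 mul0r.
have w20 : 0 < absv w / 2 by rewrite divr_gt0 ?absv_gt0.
(* At [Z] the term of index [k] equals [w], so the bound of [trunc_solve] forces [|z| <= |Z|]. Hence
   [N] can be chosen from [Z] before [z] is known. *)
pose Z := qpow (- k) (w / f k).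
have fkZ : f k * qpow k Z = w by rewrite qpowVK mulrC divfK.
have [M MP] := znull_absz w20 (tau_null f Z).
pose N := maxn M `|k|.+1; have kN : (`|k| < N)%N by rewrite leq_max leqnn orbT.
have [z zw zP] := trunc_solve w kN fk0.
have zZ : absv z <= absv Z.
  have := zP _ kN; rewrite -[in leRHS]fkZ !absvM ler_pM2l ?absv_gt0//.
  by rewrite ler_absv_qpow.
have tail n : (N <= `|n|)%N -> absv (f n * qpow n z) < absv w / 2.
  rewrite geq_max => /andP[/MP + _]; apply: le_lt_trans; exact: tau_term_mono.
exists z.
  by have := zsum_tail w20 (tau_null f z) tail; rewrite zw absv_distC => /ltW.
move=> n; have [/zP//|/tail/ltW/le_trans] := ltnP `|n|%N N; apply.
by rewrite ler_pdivrMr// ler_peMr ?absv_ge0// ler1n.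
Qed.

(** Each correction at least halves the error, and completeness sums the corrections. *)
Lemma tau_solve f k w : f k != 0 ->
  exists2 x, tau_eval f x = w & forall n, absv (f n * qpow n x) <= absv w.
Proof.
move=> fk0; have [->|w0] := eqVneq w 0.
  by exists 0 => [|n]; rewrite ?tau_eval0 ?qpow0 ?mulr0.
have /choice[s sP] w' : exists z, absv (w' - tau_eval f z) <= absv w' / 2 /\
    forall n, absv (f n * qpow n z) <= absv w'.
  by have [z z1 z2] := tau_solve_approx w' fk0; exists z.
pose err := fix err i := if i is j.+1 then err j - tau_eval f (s (err j)) else w.
have errP i : absv (err i) <= absv w / 2 ^+ i.
  elim: i => [|i IH]; first by rewrite expr0 divr1.
  rewrite /= (le_trans (sP _).1)// exprSr invfM mulrA ler_wpM2r// invr_ge0 ler0n//.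
have err0 : null err.
  move=> e e0; have w1 : 0 < absv w by rewrite absv_gt0.
  have h1 : `|2^-1 : R| < 1 by rewrite ger0_norm ?invr_ge0// invf_lt1// ltr1n.
  have ew : 0 < e / absv w by rewrite divr_gt0.
  have /cvgr0Pnorm_lt/(_ _ ew)[N _ NP] := cvg_expr h1.
  exists N => // i /NP /=; rewrite ger0_norm ?exprn_ge0 ?invr_ge0// => iw.
  by rewrite (le_lt_trans (errP i))// mulrC -ltr_pdivlMr// -exprVn.
(* The corrections tend to 0 with the error, which bounds their term of index [k]. *)
pose u i := s (err i).
have u0 : null u.
  move=> e /(coef_small fk0)[d d0 dP]; have [N _ NP] := err0 _ d0.
  by exists N => // i /NP /= id; apply: dP; exact: le_lt_trans ((sP _).2 k) id.
have fS i : tau_eval f (series u i) = w - err i.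
  elim: i => [|i IH]; first by rewrite /series /= big_nil tau_eval0 subrr.
  by rewrite seriesSr tau_evalD IH /= opprB -addrA [- err i + _]addrC.
have bnd n i : absv (f n * qpow n (series u i)) <= absv w.
  elim: i => [|i IH]; first by rewrite /series /= big_nil qpow0 mulr0 absv0
    absv_ge0.
  rewrite seriesSr qpowD mulrDr absvD_le// (le_trans ((sP _).2 n))//.
  rewrite (le_trans (errP i))// ler_pdivrMr ?exprn_gt0//.
  by rewrite ler_peMr ?absv_ge0// exprn_ege1// ler1n.
have lim0 := series_limP u0; set x := limn _ in lim0.
exists x.
  apply/eqP; rewrite -subr_eq0; apply/eqP/null_const => e e0.
  have [d d0 dP] := tau_eval_small f e0.
  near=> i; have -> : tau_eval f x - w = tau_eval f (x - series u i) - err i.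
    by rewrite tau_evalB fS opprB addrA addrAC addrK.
  apply: absvD_lt; last by rewrite absvN; near: i; exact: err0.
  by apply: dP; near: i; exact: lim0.
(* The term bound passes to the limit: [x] differs from some partial sum by an element all of whose
   terms are below [|w|]. *)
move=> n; have w1 : 0 < absv w by rewrite absv_gt0.
have [d d0 dP] := tau_term_small f w1.
have [N _ /(_ N (leqnn _)) /= NP] := lim0 _ d0.
rewrite -(subrK (series u N) x) qpowD mulrDr absvD_le//.
by apply/ltW/dP.
Unshelve. all: by end_near. Qed.

(* Up to an element that is small by trunc_solve, a zero of f of bounded
   absolute value is a zero of a fixed truncation. *)
Lemma tau_ker_totally_bounded f k (Z : C) (e : R) : f k != 0 -> 0 < e ->
  exists S : seq C, forall z, tau_eval f z = 0 -> absv z <= absv Z ->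
    exists2 x, x \in S & absv (z - x) < e.
Proof.
move=> fk0 /(coef_small fk0)[d d0 dP].
have [M MP] := znull_absz d0 (tau_null f Z).
pose N := maxn M `|k|.+1; have kN : (`|k| < N)%N by rewrite leq_max leqnn orbT.
have [S SP] := trunc_ker_finite kN fk0; exists S => z fz zZ.
have [x xz xP] := trunc_solve (zpart (fun n => f n * qpow n z) N) kN fk0.
exists (z - x).
  apply: SP; rewrite -[RHS](subrr (zpart (fun n => f n * qpow n z) N)).
  rewrite -[in X in _ = _ - X]xz !zpartE.
  by rewrite -sumrB; apply: eq_bigr => i _; rewrite qpowD qpowN mulrBr.
rewrite opprB addrC subrK; apply: dP; apply: le_lt_trans (xP _ kN) _.
(* As [z] is a zero, its truncated sum is minus its tail, which is below [d]. *)
rewrite -absvN -sub0r -fz; apply: zsum_tail => //; first exact: tau_null.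
move=> n; rewrite geq_max => /andP[/MP + _]; apply: le_lt_trans.
exact: tau_term_mono.
Qed.

End solving.

(** * Quotients by [1 - tau] and their adjoints *)

Section duality.
Context {R : realType} {F : finFieldType} {C : nonArchClosedField R F}.
Implicit Types (x y z : C) (f g h : tauSeries C) (n k : int).

(** This is [f o x = g o (1 - tau)] compared coefficientwise, see [tau_quoP]. *)
Definition tau_quotient f x g := forall n, f n * qpow n x = g n - g (n - 1).

Lemma tau_quotient_ex f x : tau_eval f x = 0 -> exists g, tau_quotient f x g.
Proof. by move=> /tau_quo_ex[g /tau_quoP fg]; exists g. Qed.

Lemma adjK : involutive (@adj R F C).
Proof.
by move=> f; apply: tauSeries_eq => n; rewrite /= /adj_coef opprK qpowVK.
Qed.

Lemma adj_neq0 f n : f n != 0 -> adj f (- n) != 0.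
Proof.
apply: contra => /eqP; rewrite /= /adj_coef opprK => fn.
by rewrite -(qpowVK n (f n)) fn qpow0.
Qed.

Lemma tau_evalE_adj f y : tau_eval (adj f) y = zsum (fun n => qpow n (f (- n) * y)).
Proof. by congr zsum; apply/funext => n; rewrite qpowM. Qed.

Lemma tau_null_adj f y : znull (fun n => qpow n (f (- n) * y)).
Proof.
by have := tau_null (adj f) y; congr znull; apply/funext => n; rewrite qpowM.
Qed.

(* Adjoint of f o x = g o (1 - tau), evaluated at y. *)
Lemma tau_quotient_adj f x g y : tau_quotient f x g ->
  qpow 1 (tau_eval (adj g) y) - tau_eval (adj g) y =
  qpow 1 (x * tau_eval (adj f) y).
Proof.
move=> fg; have A0 := tau_null_adj g y; have B0 := tau_null_adj f y.
have A0S := (znullS _).1 A0; rewrite !tau_evalE_adj.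
rewrite -zsum_qpow1// -[X in _ - X]zsumS// -mulN1r -(zsumM (-1))//.
rewrite -zsumD; [|exact: znull_qpow1|exact: znullM].
rewrite qpowM -zsum_qpow1// -zsumM; last exact: znull_qpow1.
congr zsum; apply/funext => n.
rewrite mulN1r -!qpow_comp [1 + n]addrC -qpowN -qpowD -mulNr -mulrDl opprD -fg.
rewrite mulrAC mulrC [in LHS]qpowM -qpow_comp; congr (_ * _).
by rewrite addrAC subrr add0r.
Qed.

(* With k = h^* o x - c, which vanishes at 1, write k = l o (1 - tau). Both
   y o f o x = y o g o (1 - tau) and y o f o x = (1 - tau^-1) o h^* o x then
   give y o g = (1 - tau^-1) o l - c tau^-1, whose adjoint maps 1 to -c. *)
Lemma tau_quotient_antisym f x g y h (c : F) :
  tau_quotient f x g -> tau_quotient (adj f) y h ->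
  tau_eval (adj h) x = Femb c -> tau_eval (adj g) y = - Femb c.
Proof.
move=> fg fh hx; pose eps := tau_const (Femb c : C).
have eps0 n : n != 0 -> eps n = 0 by rewrite /eps /tau_const => /negbTE ->.
have epsq m n : qpow m (eps n) = eps n.
  by rewrite /eps /tau_const; case: ifP => _; rewrite ?qpow_Femb ?qpow0.
pose k n := qpow n (h (- n) * x).
have k0 : znull k by exact: tau_null_adj.
have KP z : zcvg (fun n => (k n - eps n) * qpow n z).
  have ez : znull (fun n => - (eps n * qpow n z)).
    by apply: (@znull_supp1 _ _ _ _ 0) => n /eps0 ->; rewrite mul0r oppr0.
  apply/zcvgP; have := znullD (tau_null_adj h (x * z)) ez.
  by congr znull; apply/funext => n; rewrite /k mulrA [in LHS]qpowM mulrBl.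
pose K := TauSeries KP.
have /tau_quotient_ex[l lP] : tau_eval K 1 = 0.
  have -> : tau_eval K 1 = zsum (fun n => k n + -1 * eps n).
    by congr zsum; apply/funext => n; rewrite /= qpow1 mulr1 mulN1r.
  have e0 : znull eps by apply: znull_supp1; exact: eps0.
  rewrite zsumD//; last exact: znullM.
  rewrite zsumM// (zsum_supp1 eps0) mulN1r /eps /tau_const eqxx.
  by rewrite -hx tau_evalE_adj subrr.
have {}lP n : l n - l (n - 1) = k n - eps n by rewrite -lP qpow1 mulr1.
(* Up to sign and a [q]-th power, this compares the coefficients of [tau^n] in
   [y o f o x = (1 - tau^-1) o h^* o x]. *)
have kS n : k (n + 1) - qpow 1 (k n) = - qpow 1 (y * (f n * qpow n x)).
  rewrite /k -qpow_comp [1 + n]addrC -qpowN -qpowD -mulNr -mulrDl.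
  rewrite opprD [- n - 1]addrC [-1 - n]addrC.
  have -> : h (- n - 1) - h (- n) = - (adj f (- n) * qpow (- n) y).
    by rewrite fh opprB.
  rewrite mulNr qpowN [n + 1]addrC qpow_comp /= /adj_coef opprK !qpowM !qpowVK.
  by congr (- _); ring.
(* [D n] is the [q]-th power of the coefficient of [tau^n] in [y o g - (1 - tau^-1) o l + c tau^-1].
   It is constant because composing this series with [1 - tau] on the right gives 0, and it vanishes
   because it tends to 0. *)
pose D n := qpow 1 (y * g n + eps (n + 1) - l n) + l (n + 1).
have DS n : D n = D (n - 1).
  apply/eqP; rewrite -subr_eq0 /D subrK.
  have -> : forall a b c d : C,
      qpow 1 a + b - (qpow 1 c + d) = qpow 1 (a - c) + (b - d).
    by move=> a b a' d; rewrite qpowD qpowN opprD addrACA.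
  have -> : l (n + 1) - l n = k (n + 1) - eps (n + 1) by rewrite -lP addrK.
  have -> : y * g n + eps (n + 1) - l n - (y * g (n - 1) + eps n - l (n - 1)) =
     y * (f n * qpow n x) + eps (n + 1) - k n.
    have := lP n; rewrite fg => lPn; rewrite -[k n](subrK (eps n)) -lPn; ring.
  rewrite -[k (n + 1)](subrK (qpow 1 (k n))) kS !qpowD qpowN epsq; apply/eqP; ring.
have D0 n : D n = 0.
  rewrite (int_const DS); apply: null_const.
  have [_ g0] := znullM y (coef_null g); have [_ l0] := coef_null l.
  have [_ l1] := (znullS _).1 (coef_null l).
  have [_ e1] : znull (fun n => eps (n + 1)).
    by apply/(znullS eps).1/znull_supp1; exact: eps0.
  apply: eq_null (nullD (null_qpow1 (nullD (nullD g0 e1) (nullN l0))) l1) => i.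
  by rewrite -(int_const DS (Negz i)).
have A0 := coef_null (adj l).
have A1 := znull_shift (-1) A0.
pose e1 n := - eps (- n + 1).
have e1P n : n != 1 -> e1 n = 0.
  by move=> n1; rewrite /e1 eps0 ?oppr0// addrC subr_eq0 eq_sym.
have -> : tau_eval (adj g) y = zsum (fun n => adj l n + -1 * adj l (n - 1) + e1 n).
  rewrite tau_evalE_adj; congr zsum; apply/funext => n.
  have -> : g (- n) * y = l (- n) - eps (- n + 1) - qpow (-1) (l (- n + 1)).
    have /eqP := D0 (- n); rewrite /D addr_eq0 => /eqP /(congr1 (qpow (-1))).
    rewrite qpowK qpowN mulrC => <-; ring.
  rewrite !qpowD !qpowN epsq -qpow_comp mulN1r /e1 /= /adj_coef.
  by rewrite opprB [1 - n]addrC addrAC.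
rewrite zsumD; [|exact/znullD/znullM|exact: znull_supp1 e1P].
rewrite zsumD//; last exact: znullM.
rewrite zsumM// -[zsum (fun n => adj l (n - 1))]zsumS// (zsum_supp1 e1P) /e1.
have -> : (fun n => adj l (n + 1 - 1)) = adj l by apply/funext => n; rewrite addrK.
by rewrite mulN1r subrr add0r addNr /eps /tau_const eqxx.
Qed.

(** The coefficients of [g] tend to 0 at minus infinity, and each step upwards adds one term of [f]
    at [x]. *)
Lemma tau_quotient_lt f x g (e : R) : 0 < e -> tau_quotient f x g ->
  (forall n, absv (f n * qpow n x) < e) -> forall n, absv (g n) < e.
Proof.
move=> e0 fg fe n; have [N _ /(_ N (leqnn _)) /=] := null_down n (coef_null g) e0.
elim: N => [|N IH]; first by rewrite subr0.
move=> gN; apply: IH; rewrite -(subrK (g (n - N%:Z - 1)) (g _)) -fg.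
by apply: absvD_lt => //; rewrite -addrA -opprD PoszS1.
Qed.

Lemma tau_eval_adj_lt1 g y : (forall n, absv (g n * y) < 1) ->
  absv (tau_eval (adj g) y) < 1.
Proof.
move=> gy; rewrite tau_evalE_adj; apply: absv_zsum_lt; first exact: tau_null_adj.
by move=> n; rewrite absv_qpow_lt1.
Qed.

(** A large term is a difference of coefficients of [g], so some [g j] is large, and solving for the
    value 1 by [tau_solve] bounds [y]. As 1 is its own [q]-th power, [tau_quotient_adj] makes [y] a
    zero of [adj f]. *)
Lemma tau_quotient_solve f x g k (d : R) : 0 < d -> tau_quotient f x g ->
  d <= absv (f k * qpow k x) ->
  exists y, [/\ tau_eval (adj f) y = 0, tau_eval (adj g) y = 1 & absv y <= d^-1].
Proof.
move=> d0 fg dfx.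
have [j dj] : exists j, d <= absv (g j).
  have := le_trans dfx (le_trans _ (absvB (g k) (g (k - 1)))).
  rewrite fg lexx => /(_ isT).
  by rewrite le_max => /orP[?|?]; [exists k|exists (k - 1)].
have gj0 : g j != 0 by rewrite -absv_gt0 (lt_le_trans d0).
have [y y1 yP] := tau_solve 1 (adj_neq0 gj0); exists y; split => //.
  have := tau_quotient_adj y fg; rewrite y1 qpow1 subrr => fy.
  have /eqP : x * tau_eval (adj f) y = 0 by rewrite -(qpowK 1 (x * _)) -fy qpow0.
  rewrite mulf_eq0.
  have [x0|_ /eqP//] := eqVneq x 0.
  by move: dfx; rewrite x0 qpow0 mulr0 absv0 leNgt d0.
have := yP (- j); rewrite /= /adj_coef opprK -qpowM absv1 absv_qpow_le1 absvM => gy.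
rewrite -[leRHS]mul1r ler_pdivlMr// mulrC (le_trans _ gy)//.
by rewrite ler_wpM2r ?absv_ge0.
Qed.

End duality.

(** * Compactness of balls in the kernel *)

Section kernel_topology.
Context {R : realType} {F : finFieldType} {C : nonArchClosedField R F}.
Variable f : tauSeries C.
Implicit Types (x y z : C) (a b : ker f).

Lemma ker_valD a b : ker_val (a + b) = ker_val a + ker_val b.
Proof. by []. Qed.

Lemma ker_valZ (c : F) a : ker_val (c *: a) = Femb c * ker_val a.
Proof. by []. Qed.

Lemma ker_val0 : ker_val (0 : ker f) = 0.
Proof. by []. Qed.

Lemma ker_valB a b : ker_val (a - b) = ker_val a - ker_val b.
Proof. by []. Qed.

Lemma ker_ex x : tau_eval f x = 0 -> exists a : ker f, ker_val a = x.
Proof. by move=> fx; exists (SigSub (mem_set fx : x \in ker_set f)). Qed.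

Lemma nbhs_kerP a (A : set (ker f)) : nbhs a A <->
  exists2 d : R, 0 < d & forall b, absv (ker_val (b - a)) < d -> A b.
Proof.
split=> [[_ [[B Bop <-] Ba sBA]]|[d d0 dA]].
  have /nbhs_ballP[d d0 dB] : nbhs (ker_val a) B by apply: open_nbhs_nbhs; split.
  exists d => // b ba; apply/sBA/dB.
  by rewrite ball_absv /= absv_distC.
have : nbhs a [set b : ker f | ball (ker_val a) d (ker_val b)].
  by have /(@initial_continuous _ _ (@set_val _ (ker_set f)) a) :=
    nbhsx_ballx (ker_val a) d d0.
apply: filterS => b.
by rewrite /= ball_absv /= => ab; apply: dA; rewrite ker_valB absv_distC.
Qed.

Lemma absv_ker_lin (c : F) a b (r : R) :
  absv (ker_val a) <= r -> absv (ker_val b) <= r ->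
  absv (ker_val (c *: a + b)) <= r.
Proof.
move=> ar br; rewrite ker_valD ker_valZ; apply: absvD_le => //.
rewrite absvM; have [->|c0] := eqVneq c 0.
  by rewrite rmorph0 absv0 mul0r (le_trans (absv_ge0 _) ar).
by rewrite absv_Femb// mul1r.
Qed.

(** The absolute value may be trivial, and then 1 dominates everything. *)
Lemma absv_bound_ex (r : R) :
  exists Z : C, forall x, absv x <= r -> absv x <= absv Z.
Proof.
have [[x x1]|triv] := pselect (exists x : C, 1 < absv x).
  by have [Z rZ] := absv_unbounded r x1; exists Z => y /le_trans; apply.
by exists 1 => x _; rewrite absv1 leNgt; apply/negP => x1; apply: triv; exists x.
Qed.

Lemma ultra_finite_cover (U : set_system (ker f)) (S : seq C) (e : R) :
  UltraFilter U ->
  U [set a | exists2 x, x \in S & absv (ker_val a - x) < e] ->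
  exists x, U [set a | absv (ker_val a - x) < e].
Proof.
move=> UU; elim: S => [|x S IH] US.
  by have [] := @filter_not_empty _ U _; apply: filterS US => a [].
have [Ux|Ux] := in_ultra_setVsetC [set a | absv (ker_val a - x) < e] UU.
  by exists x.
apply: IH; apply: filterS2 Ux US => a /= ax [y].
by rewrite inE => /predU1P[->//|yS ya]; exists y.
Qed.

(** Total boundedness puts a ball of radius [1 / (n + 1)] in the ultrafilter for each [n]; the
    centres form a Cauchy sequence whose limit is the point sought. *)
Lemma ker_compact k (r : R) : f k != 0 ->
  compact [set a : ker f | absv (ker_val a) <= r].
Proof.
move=> fk0; rewrite compact_ultra /= => U UU Ur.
have [Z ZP] := absv_bound_ex r.
have /choice[c cP] (n : nat) :
    exists x, U [set a | absv (ker_val a - x) < n.+1%:R^-1].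
  have n0 : 0 < n.+1%:R^-1 :> R by rewrite invr_gt0.
  have [S SP] := tau_ker_totally_bounded Z fk0 n0.
  apply: (@ultra_finite_cover _ S); apply: filterS Ur => a ar.
  by apply: SP; [exact: ker_valP|exact: ZP].
have small (e : R) : 0 < e -> exists N, forall n, (N <= n)%N -> n.+1%:R^-1 < e.
  move=> e0; have [N _ NP] := near_infty_natSinv_lt (PosNum e0).
  by exists N => n /NP.
have [|l lP] := @nacf_complete _ _ C c.
  move=> e /small[N NP]; exists N => m n Nm Nn.
  have [a [am an]] := filter_ex (filterI (cP m) (cP n)).
  have -> : c m - c n = (c m - ker_val a) + (ker_val a - c n).
    by rewrite addrA subrK.
  apply: absvD_lt; first by rewrite absv_distC (lt_trans am)// NP.
  by rewrite (lt_trans an)// NP.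
have Ul (e : R) : 0 < e -> U [set a | absv (ker_val a - l) < e].
  move=> e0; have [N1 N1P] := lP e e0; have [N2 N2P] := small e e0.
  have := cP (maxn N1 N2); apply: filterS => a /= aN.
  rewrite -(subrK (c (maxn N1 N2)) (ker_val a)) -addrA; apply: absvD_lt.
    by rewrite (lt_trans aN)// N2P// leq_maxr.
  by apply: N1P; exact: leq_maxl.
have fl : tau_eval f l = 0.
  apply: null_const => e e0; apply: nearW => _.
  have [d d0 dP] := tau_eval_small f e0.
  have [a ad] := filter_ex (Ul _ d0).
  by have := dP _ ad; rewrite tau_evalB ker_valP sub0r absvN.
have [b bl] := ker_ex fl; exists b; split.
  (* If [|l| > r], a point of the ball closer to [l] than [|l|] would give [|l| < |l|]. *)
  rewrite /= bl leNgt; apply/negP => rl.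
  have [a0 a0r] := filter_ex Ur.
  have l0 : 0 < absv l by rewrite (le_lt_trans _ rl)// (le_trans _ a0r)// absv_ge0.
  have [a [ar al]] := filter_ex (filterI Ur (Ul _ l0)).
  suff : absv l < absv l by rewrite ltxx.
  rewrite -[X in absv X < _](subKr (ker_val a)); apply: absvD_lt.
    exact: le_lt_trans ar rl.
  by rewrite absvN.
move=> A /nbhs_kerP[d d0 dA]; have := Ul _ d0; apply: filterS => a ad.
by apply: dA; rewrite ker_valB bl.
Qed.

End kernel_topology.

(** * Bilinearity, continuity and non-degeneracy of the pairing *)

Section pairing_theory.
Context {R : realType} {F : finFieldType} {C : nonArchClosedField R F}.
Variable f : tauSeries C.
Implicit Types (a : ker f) (b : ker (adj f)) (k : int).

Lemma tau_quotient_quo (g : tauSeries C) (a : ker g) :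
  tau_quotient g (ker_val a) (tau_quo a).
Proof. exact/tau_quoP/tau_quoE. Qed.

(** As [h] depends on [b] alone, this form exhibits linearity in [a] and lets the arguments be
    exchanged. *)
Lemma pairing_antisym a b h : tau_quotient (adj f) (ker_val b) h ->
  Femb (pairing a b) = - tau_eval (adj h) (ker_val a).
Proof.
move=> hb; have ha : tau_eval (adj (adj f)) (ker_val a) = 0.
  by rewrite adjK ker_valP.
have [c cP] := tau_quo_Fq ((tau_quoP _ _ _).2 hb) ha.
by rewrite pairingE (tau_quotient_antisym (tau_quotient_quo a) hb (esym cP)) cP.
Qed.

Lemma pairing_linl (c : F) a a' b :
  pairing (c *: a + a') b = c * pairing a b + pairing a' b.
Proof.
have pE a0 := pairing_antisym a0 (tau_quotient_quo b).
have key (p p' p'' : F) (T : tauSeries C) (x x' : C) :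
    Femb p = - tau_eval T x -> Femb p' = - tau_eval T x' ->
    Femb p'' = - tau_eval T (Femb c * x + x') -> p'' = c * p + p'.
  move=> ep ep' ep''; apply: (fmorph_inj (@Femb R F C)).
  by rewrite rmorphD rmorphM /= ep ep' ep'' tau_evalD tau_evalZ opprD mulrN.
exact: key (pE a) (pE a') (pE (c *: a + a')).
Qed.

Lemma pairing_linr (c : F) a b b' :
  pairing a (c *: b + b') = c * pairing a b + pairing a b'.
Proof.
apply: (fmorph_inj (@Femb R F C)); rewrite rmorphD rmorphM /= !pairingE.
by rewrite ker_valD ker_valZ tau_evalD tau_evalZ.
Qed.

(** The value lies in [F], whose nonzero elements have absolute value 1. *)
Lemma pairing_eq0 a b : (forall n, absv (tau_quo a n * ker_val b) < 1) ->
  pairing a b = 0.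
Proof.
move=> /tau_eval_adj_lt1; rewrite -pairingE => p1.
by apply/eqP; apply: contraTT p1 => p0; rewrite absv_Femb// ltxx.
Qed.

(** Small [a] has small terms, hence by [tau_quotient_lt] a quotient with small coefficients,
    uniformly for [b] in a ball. *)
Lemma pairing_small_l (r : R) : exists2 d : R, 0 < d & forall a b,
  absv (ker_val a) < d -> absv (ker_val b) <= r -> pairing a b = 0.
Proof.
pose s := Num.max 1 r; have s0 : 0 < s by rewrite lt_max ltr01.
have sV0 : 0 < s^-1 by rewrite invr_gt0.
have [d d0 dP] := tau_term_small f sV0.
exists d => // a b /dP ad br; apply: pairing_eq0 => n; rewrite absvM.
have gs := tau_quotient_lt sV0 (tau_quotient_quo a) ad n.
have bs : absv (ker_val b) <= s by rewrite le_max br orbT.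
by rewrite (le_lt_trans (ler_wpM2l (absv_ge0 _) bs))// -ltr_pdivlMr// mul1r.
Qed.

Lemma pairing_small_r a : exists2 d : R, 0 < d & forall b,
  absv (ker_val b) < d -> pairing a b = 0.
Proof.
have [B BP] := znull_bounded (coef_null (tau_quo a)).
have B0 : 0 < B + 1 by rewrite ltr_wpDl// (le_trans (absv_ge0 _) (BP 0)).
exists (B + 1)^-1 => [|b bB]; first by rewrite invr_gt0.
apply: pairing_eq0 => n; rewrite absvM.
have gB : absv (tau_quo a n) <= B + 1 by rewrite (le_trans (BP n))// lerDl.
by rewrite (le_lt_trans (ler_wpM2r (absv_ge0 _) gB))// mulrC -ltr_pdivlMr// mul1r.
Qed.

(** The values differ by the pairings of [a - a0] with [b] and of [a0] with [b - b0], which both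
    vanish near [(a0, b0)]. *)
Lemma pairing_continuous : continuous (fun w : ker f * ker (adj f) =>
  pairing w.1 w.2 : discrete_topology F).
Proof.
move=> [a0 b0] A /principal_filterP A0.
have [d d0 dP] := pairing_small_l (Num.max (absv (ker_val b0)) 1).
have [d' d'0 d'P] := pairing_small_r a0.
exists ([set a | absv (ker_val (a - a0)) < d],
        [set b | absv (ker_val (b - b0)) < Num.min 1 d']).
  split; apply/nbhs_kerP; first by exists d.
  by exists (Num.min 1 d') => //; rewrite lt_min ltr01.
move=> [a b] [/= aa0]; rewrite lt_min => /andP[b1 bd'].
suff -> : pairing a b = pairing a0 b0 by [].
have -> : a = 1 *: (a - a0) + a0 by rewrite scale1r subrK.
rewrite pairing_linl (dP _ _ aa0) ?mulr0 ?add0r; last first.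
  rewrite -(subrK b0 b) ker_valD; apply: (le_trans (absvD _ _)).
  by rewrite ge_max !le_max lexx (ltW b1) orbT.
have -> : b = 1 *: (b - b0) + b0 by rewrite scale1r subrK.
by rewrite pairing_linr (d'P _ bd') mulr0 add0r.
Qed.

(** If the term of index [k] at [a] had size at least [d], [tau_quotient_solve] would give a [b] in
    the ball of radius [d^-1] pairing to 1 with [a]. *)
Lemma pairing_sep_l k (e : R) : f k != 0 -> 0 < e -> exists s : R, forall a,
  (forall b, absv (ker_val b) <= s -> pairing a b = 0) -> absv (ker_val a) < e.
Proof.
move=> fk0 /(coef_small fk0)[d d0 dP]; exists d^-1 => a a0; apply: dP.
rewrite ltNge; apply/negP => da.
have [y [fy gy yd]] := tau_quotient_solve d0 (tau_quotient_quo a) da.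
have [b by_] := ker_ex fy; have := a0 b; rewrite by_ => /(_ yd) p0.
by have := pairingE a b; rewrite by_ gy p0 rmorph0 => /eqP; rewrite eq_sym oner_eq0.
Qed.

Lemma pairing_sep_r k (e : R) : f k != 0 -> 0 < e -> exists s : R, forall b,
  (forall a, absv (ker_val a) <= s -> pairing a b = 0) -> absv (ker_val b) < e.
Proof.
move=> /adj_neq0 fk0 /(coef_small fk0)[d d0 dP]; exists d^-1 => b b0; apply: dP.
rewrite ltNge; apply/negP => db.
have [x []] := tau_quotient_solve d0 (tau_quotient_quo b) db.
rewrite adjK => fx hx xd.
have [a ax] := ker_ex fx; have := b0 a; rewrite ax => /(_ xd) p0.
have := pairing_antisym a (tau_quotient_quo b); rewrite ax hx p0 rmorph0.
by move=> /eqP; rewrite eq_sym oppr_eq0 oner_eq0.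
Qed.

End pairing_theory.

(** Since [F] is finite, [W] is the row space of the matrix listing its elements, and the columns of
    the cokernel matrix are forms that cut out [W]. *)
Lemma separating_form (F : finFieldType) (n : nat)
    (W : set 'rV[F]_n) (v : 'rV[F]_n) :
  W 0 -> (forall c u w, W u -> W w -> W (c *: u + w)) -> ~ W v ->
  exists2 c : 'cV[F]_n, forall w, W w -> w *m c = 0 & v *m c != 0.
Proof.
move=> W0 Wlin Wv; pose s := enum [pred w : 'rV[F]_n | `[< W w >]].
have sP w : reflect (W w) (w \in s) by rewrite mem_enum inE; exact: asboolP.
pose M := \matrix_(i < size s) nth 0 s i.
have MW w : W w -> (w <= M)%MS.
  move=> /sP ws; have iw : (index w s < size s)%N by rewrite index_mem.
  have -> : w = row (Ordinal iw) M by rewrite rowK /= nth_index.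
  exact: row_sub.
have /rV0Pn[j vj] : v *m cokermx M != 0.
  rewrite -submxE; apply/negP => /submxP[D vD]; apply: Wv.
  rewrite vD mulmx_sum_row; elim/big_ind: _ => // [x y Wx Wy|i _].
    by rewrite -[x]scale1r; exact: Wlin.
  rewrite -[_ *: _]addr0; apply: Wlin => //; rewrite rowK.
  by apply/sP; rewrite mem_nth.
have colM (w : 'rV[F]_n) : w *m col j (cokermx M) = col j (w *m cokermx M).
  by apply/colP => i; rewrite !mxE; apply: eq_bigr => l _; rewrite !mxE.
exists (col j (cokermx M)) => [w /MW|].
  by rewrite colM submxE => /eqP ->; apply/colP => i; rewrite !mxE.
by apply: contraNneq vj; rewrite colM => /colP/(_ 0); rewrite mxE [RHS]mxE => ->.
Qed.

(** * Duality for an abstract separating pairing, applicable in both orders of the arguments *)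

Section abstract_duality.
Context {R : realType} {F : finFieldType} {C : nonArchClosedField R F}.

Variables (f f' : tauSeries C) (P : ker f -> ker f' -> F).
Hypothesis P_linl : forall c a a' b, P (c *: a + a') b = c * P a b + P a' b.
Hypothesis P_linr : forall c a b b', P a (c *: b + b') = c * P a b + P a b'.
Hypothesis P_cont : continuous (fun w : ker f * ker f' =>
  P w.1 w.2 : discrete_topology F).
Hypothesis cptl : forall r : R, compact [set a : ker f | absv (ker_val a) <= r].
Hypothesis cptr : forall r : R, compact [set b : ker f' | absv (ker_val b) <= r].
Hypothesis P_sepl : forall e : R, 0 < e -> exists s : R, forall a,
  (forall b, absv (ker_val b) <= s -> P a b = 0) -> absv (ker_val a) < e.
Hypothesis P_sepr : forall e : R, 0 < e -> exists s : R, forall b,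
  (forall a, absv (ker_val a) <= s -> P a b = 0) -> absv (ker_val b) < e.

Let P0l b : P 0 b = 0.
Proof. by have := P_linl (-1) 0 0 b; rewrite scaler0 addr0 mulN1r addNr. Qed.

Let P0r a : P a 0 = 0.
Proof. by have := P_linr (-1) a 0 0; rewrite scaler0 addr0 mulN1r addNr. Qed.

Let dual0 (phi : dual f') : phi 0 = 0.
Proof.
by have := dual_linear phi (-1) 0 0; rewrite scaler0 addr0 scaleN1r addNr.
Qed.

Let PBl a a' b : P (a - a') b = P a b - P a' b.
Proof.
by have := P_linl (-1) a' a b; rewrite scaleN1r addrC mulN1r [in RHS]addrC.
Qed.

Let P_sumr a n (c : 'I_n -> F) (b : 'I_n -> ker f') :
  P a (\sum_i c i *: b i) = \sum_i c i * P a (b i).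
Proof.
elim: n c b => [|n IH] c b; first by rewrite !big_ord0 P0r.
by rewrite !big_ord_recl P_linr IH.
Qed.

Let dual_sum (phi : dual f') n (c : 'I_n -> F) (b : 'I_n -> ker f') :
  phi (\sum_i c i *: b i) = \sum_i c i * phi (b i).
Proof.
elim: n c b => [|n IH] c b; first by rewrite !big_ord0 dual0.
by rewrite !big_ord_recl dual_linear IH.
Qed.

Let P_dual a : P a \in @dual_set _ _ _ f'.
Proof.
apply/mem_set; split=> [c b b'|]; first exact: P_linr.
exact: (continuous_curry P_cont).2.
Qed.

Let Phi a : dual f' := SigSub (P_dual a).

Let PhiE a b : Phi a b = P a b.
Proof. by []. Qed.

Let Phi_continuous : continuous Phi.
Proof.
apply: (@continuous_comp_initial _ _ _ (@set_val _ (@dual_set _ _ _ f')) Phi).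
exact: (continuous_curry P_cont).1.
Qed.

Let Phi_inj : injective Phi.
Proof.
move=> a a' aa'; apply: ker_val_inj; apply/eqP; rewrite -subr_eq0 -absv_eq0.
apply: contraT => n0; have d0 : 0 < absv (ker_val a - ker_val a').
  by rewrite lt_neqAle eq_sym n0 absv_ge0.
have [s /(_ (a - a'))] := P_sepl d0; rewrite ker_valB ltxx; apply=> b _.
by rewrite PBl -!PhiE aa' subrr.
Qed.

(* A form phi vanishes on the annihilator of some compact ball of ker f. If no
   element of that ball represented phi, then by compactness phi would already
   fail to be represented on finitely many vectors, and finite-dimensional
   duality would give an element of the annihilator on which phi is nonzero. *)
Let Phi_surj (phi : dual f') : exists a, Phi a = phi.
Proof.
have /nbhs_kerP[d d0 dP] := dual_locconst phi 0.
have [s [s0 sP]] : exists s : R, 0 <= s /\ forall b,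
    (forall a, absv (ker_val a) <= s -> P a b = 0) -> absv (ker_val b) < d.
  (* The maximum makes the ball contain 0, which [separating_form] requires of [W]. *)
  have [s sP] := P_sepr d0; exists (Num.max 0 s).
  split; first by rewrite le_max lexx.
  by move=> b b0; apply: sP => a ar; apply: b0; rewrite le_max ar orbT.
apply: contrapT => noa.
have noP a : exists b, P a b != phi b.
  apply: contrapT => nob; apply: noa; exists a; apply: dual_eq => b.
  by apply/eqP; apply: contrapT => /negP Pb; apply: nob; exists b.
have [bs bsP] : exists bs : seq (ker f'), forall a, absv (ker_val a) <= s ->
    exists2 b, b \in bs & P a b != phi b.
  (* Along the filter [G] of lists containing prescribed vectors, the near-covering form of
     compactness produces a single list valid for the whole ball. *)
  pose G := filter_from setT (fun bs0 : seq (ker f') =>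
    [set bs : seq (ker f') | {subset bs0 <= bs}]).
  have FG : Filter G.
    apply: filter_from_filter; first by exists [::].
    move=> bs bs' _ _; exists (bs ++ bs') => // bs2 sub2; split=> b bb; apply: sub2.
      by rewrite mem_cat bb.
    by rewrite mem_cat bb orbT.
  pose Q (bs : seq (ker f')) a := exists2 b, b \in bs & P a b != phi b.
  have /compact_near_coveringP/(_ _ G Q FG) := @cptl s.
  case=> [a _|bs _ bsP]; last by exists bs => a ar; apply: bsP.
  have [b Pb] := noP a.
  have Pb' : nbhs (P a b : discrete_topology F) [set c | c != phi b].
    exact/principal_filterP.
  have [[A1 B1] [/= A1a B1b] AB] := @P_cont (a, b) _ Pb'.
  exists (A1, [set bs : seq (ker f') | {subset [:: b] <= bs}]).
    by split=> //; exists [:: b].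
  move=> [a' bs] [/= A1a' bbs]; exists b; first by apply: bbs; rewrite inE.
  by apply: (AB (a', b)); split=> //; exact: nbhs_singleton.
pose n := size bs.
pose W : set 'rV[F]_n :=
  [set w | exists2 a, absv (ker_val a) <= s & w = \row_i P a (nth 0 bs i)].
pose v : 'rV[F]_n := \row_i phi (nth 0 bs i).
have [|||c cW cv] := @separating_form F n W v.
- exists 0; first by rewrite ker_val0 absv0.
  by apply/rowP => i; rewrite !mxE P0l.
- move=> c _ _ [a ar ->] [a' a'r ->]; exists (c *: a + a').
    exact: absv_ker_lin.
  by apply/rowP => i; rewrite !mxE P_linl.
- move=> [a ar va]; have [b bbs /eqP] := bsP a ar; apply.
  have ib : (index b bs < n)%N by rewrite index_mem.
  have := congr1 (fun w : 'rV_n => w 0 (Ordinal ib)) va.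
  by rewrite !mxE /= nth_index// => ->.
(* By the choice of [c], the ball annihilates [b0], which is therefore small and killed by [phi],
   whereas [v *m c] is nonzero. *)
pose b0 := \sum_i c i 0 *: nth 0 bs i.
have vb : (v *m c) 0 0 = phi b0.
  by rewrite dual_sum mxE; apply: eq_bigr => i _; rewrite !mxE mulrC.
have phib0 : phi b0 = 0.
  rewrite (dP b0) ?dual0// subr0; apply: sP => a ar.
  have /cW/(congr1 (fun w : 'M[F]_1 => w 0 0)) : W (\row_i P a (nth 0 bs i)).
    by exists a.
  rewrite mxE [RHS]mxE => <-; rewrite P_sumr; apply: eq_bigr => i _.
  by rewrite !mxE mulrC.
by move: cv; rewrite [v *m c]mx11_scalar vb phib0 raddf0 eqxx.
Qed.

(** [phi] cuts [K] into finitely many compact pieces, one per element of [F]; sending a piece to its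
    value is an open condition. *)
Let dual_near_compact (phi : dual f') (K : set (ker f')) : compact K ->
  nbhs phi [set psi : dual f' | forall b, K b -> psi b = phi b].
Proof.
move=> cK; pose U (c : F) : set {compact-open, ker f' -> discrete_topology F} :=
  [set g | g @` (K `&` phi @^-1` [set c]) `<=` [set c]].
have /filter_forall : forall c : F,
    nbhs phi [set psi : dual f' | U c (set_val psi)].
  move=> c; have oU : open (U c).
    apply: compact_open_open; last exact: discrete_open.
    apply: compact_closedI => //.
    have [_ /continuous_closedP] := set_valP phi; apply; exact: discrete_closed.
  have : nbhs (set_val phi) (U c).
    by apply: open_nbhs_nbhs; split => // _ [b [_ /= <-] <-].
  by move=> /(@initial_continuous _ _ (@set_val _ (@dual_set _ _ _ f')) phi).
apply: filterS => psi psiU b Kb.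
by apply: (psiU (phi b)); exists b.
Qed.

Lemma dual_homeomorphism : exists Phi : ker f -> dual f',
  [/\ forall a b, Phi a b = P a b, linear Phi & homeomorphism Phi].
Proof.
exists Phi; split=> //.
  by move=> c a a'; apply: dual_eq => b; exact: P_linl.
split; first exact: Phi_continuous.
have /choice[K KP] := Phi_surj; exists K; split => //.
  by move=> a; apply: Phi_inj; rewrite KP.
(* Inverse images are close once the forms agree on a large ball, which is compact. *)
move=> phi A /nbhs_kerP[d d0 dA]; have [s sP] := P_sepl d0.
have := dual_near_compact phi (@cptr s); apply: filterS => psi psiE.
by apply: dA; apply: sP => b bs; rewrite PBl -!PhiE !KP psiE// subrr.
Qed.

End abstract_duality.

Theorem theorem8p6 (R : realType) (F : finFieldType)
    (C : nonArchClosedField R F) (f : tauSeries C)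
    (f_neq0 : exists n : int, f n != 0) :
  [/\ continuous (fun w : ker f * ker (adj f) =>
        pairing w.1 w.2 : discrete_topology F),
      exists Phi : ker f -> dual (adj f),
        [/\ forall alpha beta, Phi alpha beta = pairing alpha beta,
            linear Phi & homeomorphism Phi]
    & exists Psi : ker (adj f) -> dual f,
        [/\ forall alpha beta, Psi beta alpha = pairing alpha beta,
            linear Psi & homeomorphism Psi]].

Proof.
have [k fk0] := f_neq0; have fk0' := adj_neq0 fk0.
split; first exact: pairing_continuous.
  apply: dual_homeomorphism; first exact: pairing_linl.
  - exact: pairing_linr.
  - exact: pairing_continuous.
  - by move=> r; exact: ker_compact fk0.
  - by move=> r; exact: ker_compact fk0'.
  - by move=> e; exact: pairing_sep_l fk0.
  - by move=> e; exact: pairing_sep_r fk0.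
(* Exchanging the arguments of the pairing exchanges its two separation lemmas. *)
have [|||||||Psi [PsiE Psi_lin Psi_homeo]] :=
    @dual_homeomorphism R F C (adj f) f (fun beta alpha => pairing alpha beta).
- by move=> c b b' a; exact: pairing_linr.
- by move=> c b a a'; exact: pairing_linl.
- move=> [b a] A /(pairing_continuous (x := (a, b)))[[A1 B1] [/= A1a B1b] AB].
  exists (B1, A1) => // -[b' a'] [/= B1b' A1a']; exact: (AB (a', b')).
- by move=> r; exact: ker_compact fk0'.
- by move=> r; exact: ker_compact fk0.
- by move=> e; exact: pairing_sep_r fk0.
- by move=> e; exact: pairing_sep_l fk0.
by exists Psi; split.
Qed.
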